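(* There is an infinite family of elliptic curves over $\mathbb{Q}$, with pairwise distinct $j$-invariants, such that each member of the family gains rank over infinitely many linearly disjoint cyclic extensions of $\mathbb{Q}$ of degree $3$.
   Context: An elliptic curve $E/\mathbb{Q}$ ''gains rank'' over a number field $L$ if $\operatorname{rank} E(L)>\operatorname{rank} E(\mathbb{Q})$. A family of finite extensions of $\mathbb{Q}$ is linearly disjoint if the degree of the compositum of any finitely many of them equals the product of their degrees. *)

(* Defs.v *)
(* Number fields are modelled as subfields of algC, the
   algebraic closure of Q (algebraic complex numbers). *)
From HB Require Import structures.
From mathcomp Require Import all_boot all_order all_algebra all_field.
Set Implicit Arguments. Unset Strict Implicit. Unset Printing Implicit Defensive.
Import Order.TTheory GRing.Theory Num.Theory.
Local Open Scope ring_scope.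

Definition is_subfield (K : algC -> Prop) : Prop :=
  [/\ K 0, K 1,
      (forall x y, K x -> K y -> K (x - y)),
      (forall x y, K x -> K y -> K (x * y)) &
      (forall x, K x -> x != 0 -> K x^-1)].

Definition Qfield : algC -> Prop := fun x => exists q : rat, x = ratr q.

Definition has_degree (K : algC -> Prop) (n : nat) : Prop :=
  exists b : 'I_n -> algC,
    [/\ (forall i, K (b i)),
        (forall c : 'I_n -> rat,
            \sum_(i < n) ratr (c i) * b i = 0 -> forall i, c i = 0) &
        (forall x, K x -> exists c : 'I_n -> rat, x = \sum_(i < n) ratr (c i) * b i)].

Definition compositum (K : nat -> algC -> Prop) (s : seq nat) : algC -> Prop :=
  fun x => forall F : algC -> Prop, is_subfield F ->
    (forall i y, i \in s -> K i y -> F y) -> F x.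

Definition linearly_disjoint (K : nat -> algC -> Prop) : Prop :=
  forall s : seq nat, uniq s ->
  forall d : nat -> nat, (forall i, i \in s -> has_degree (K i) (d i)) ->
    has_degree (compositum K s) (\prod_(i <- s) d i).

(** Galois theory: Gal(K/Q) is the set of restrictions to K of automorphisms
    of algC (every Q-embedding K -> algC extends to such an automorphism). *)
Definition normal_over_Q (K : algC -> Prop) : Prop :=
  forall (s : {rmorphism algC -> algC}) x, K x -> K (s x).

Definition cyclic_gal (K : algC -> Prop) : Prop :=
  exists s : {rmorphism algC -> algC},
    forall t : {rmorphism algC -> algC}, exists k : nat,
      forall x, K x -> t x = iter k s x.

Definition cyclic_cubic (K : algC -> Prop) : Prop :=
  [/\ is_subfield K, has_degree K 3, normal_over_Q K & cyclic_gal K].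

Definition ec_disc (a b : rat) : rat := 4 * a ^+ 3 + 27 * b ^+ 2.
Definition nonsingular (a b : rat) : Prop := ec_disc a b != 0.
Definition j_invariant (a b : rat) : rat := 1728 * (4 * a ^+ 3) / ec_disc a b.

(** points over algC: None is the point at infinity *)
Definition point := option (algC * algC).

Definition on_curve (a b : rat) (P : point) : Prop :=
  if P is Some (x, y) then y ^+ 2 = x ^+ 3 + ratr a * x + ratr b else True.

Definition coords_in (K : algC -> Prop) (P : point) : Prop :=
  if P is Some (x, y) then K x /\ K y else True.

Definition ec_neg (P : point) : point :=
  if P is Some (x, y) then Some (x, - y) else None.

Definition ec_add (a : rat) (P Q : point) : point :=
  match P, Q with
  | None, _ => Q
  | _, None => P
  | Some (x1, y1), Some (x2, y2) =>
      if x1 == x2 then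
        if y1 == - y2 then None
        else let l := (3 * x1 ^+ 2 + ratr a) / (2 * y1) in
             let x3 := l ^+ 2 - x1 - x2 in Some (x3, l * (x1 - x3) - y1)
      else let l := (y2 - y1) / (x2 - x1) in
           let x3 := l ^+ 2 - x1 - x2 in Some (x3, l * (x1 - x3) - y1)
  end.

Definition ec_mul (a : rat) (n : int) (P : point) : point :=
  match n with
  | Posz m => iter m (ec_add a P) None
  | Negz m => ec_neg (iter m.+1 (ec_add a P) None)
  end.

Definition rank_ge (a b : rat) (K : algC -> Prop) (n : nat) : Prop :=
  exists P : 'I_n -> point,
    [/\ (forall i, on_curve a b (P i)), (forall i, coords_in K (P i)) &
        (forall c : 'I_n -> int,
           foldr (ec_add a) None [seq ec_mul a (c i) (P i) | i <- enum 'I_n] = None ->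
           forall i, c i = 0)].

Definition gains_rank (a b : rat) (K : algC -> Prop) : Prop :=
  exists n : nat, rank_ge a b K n /\ ~ rank_ge a b Qfield n.

(* Main.v *)
(* For u > 1 put N = u^2 + u + 1, B = u (u + 1), D = (u - 1) (2 u + 1) (u + 2), so
   that 4 N^3 = D^2 + 27 B^2. The curve E : Y^2 = X^3 + (N X + B^2)^2 has torsion
   Z/2 x Z/6 over Q. The tangents at its three rational flexes meet in rational
   points, and for the pencil of lines Y = N X + B^2 + 2 e through one of them the
   discriminant of the intersection with E is a square exactly on the conic
   z^2 + 27 (e - B^2)^2 = 4 D^2 e, which has the rational point e = B^2. So E has
   infinitely many triples of conjugate points over cyclic cubic fields, each of
   sum zero. Choosing the parameter k of the conic so that k^2 + 27 is exactly
   divisible by a new prime makes the cubic Eisenstein there, and the fields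
   linearly disjoint.

   If a multiple of such a point P is a combination of rational points, then it
   equals its conjugates, and 3 times it vanishes, so P is torsion. But a conjugate
   of P lies on the egg of E(R), hence so do its odd multiples, which are therefore
   nonzero; and a point of 2-power order over the cubic field is rational, because
   E[2] is. This is a contradiction, so P is independent of E(Q). As the rank of
   E(Q) is finite (Mordell's theorem, by 2-descent with full rational 2-torsion and
   heights), it grows. *)
Require Import Defs.
From HB Require Import structures.
From mathcomp Require Import all_boot all_order all_algebra all_field.
From mathcomp Require Import ring lra zify.
From Stdlib Require Import Classical.
Set Implicit Arguments. Unset Strict Implicit. Unset Printing Implicit Defensive.
Import Order.TTheory GRing.Theory Num.Theory.
Local Open Scope ring_scope.

(** * The group law *)

(** Ramification is handled without ideals: at a prime [P] dividing none of the earlier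
    discriminants, an algebraic integer of the compositum that is nilpotent modulo [P] is divisible
    by [P], and an Eisenstein root violates this. Each new root is thus outside the compositum of
    the earlier fields, and adjoining it triples the degree. The Galois action is explicit: a square
    root of the discriminant gives the next root as a polynomial in the present one with rational
    coefficients, a formula that commutes with every field morphism. The parameter [k] must also be
    large, as this is what forces one of the three conjugate points onto the egg. The descent wants
    integral 2-torsion abscissas, so [N^2 / 3] has to be an integer; hence [u] is taken congruent to
    1 modulo 3. *)

Section Formulas.
Variable F : fieldType.
Hypothesis two_neq0 : 2 != 0 :> F.
Implicit Types x y l m n k a b : F.

(* The slopes l, m of the lines P1P2 and P2P3 are free parameters: the curve
   through the three points determines a, and equating its two expressions
   solves linearly for y2, so no curve equation is left for [field]. *)
Lemma assoc_formula x1 y1 x2 y2 x3 y3 l m n k a :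
  y1 = y2 + l * (x1 - x2) -> y3 = y2 + m * (x3 - x2) ->
  a = l * (y1 + y2) - (x1 ^+ 2 + x1 * x2 + x2 ^+ 2) ->
  a = m * (y2 + y3) - (x2 ^+ 2 + x2 * x3 + x3 ^+ 2) ->
  m - l != 0 ->
  let x4 := l ^+ 2 - x1 - x2 in let y4 := l * (x1 - x4) - y1 in
  let x6 := m ^+ 2 - x2 - x3 in let y6 := m * (x2 - x6) - y2 in
  x3 - x4 != 0 -> x6 - x1 != 0 ->
  n = (y3 - y4) / (x3 - x4) -> k = (y6 - y1) / (x6 - x1) ->
  n ^+ 2 - x4 - x3 = k ^+ 2 - x1 - x6 /\
  n * (x4 - (n ^+ 2 - x4 - x3)) - y4 = k * (x1 - (k ^+ 2 - x1 - x6)) - y1.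
Proof.
move=> -> -> -> ha hml x4 y4 x6 y6 h34 h61 -> ->.
rewrite {}/y4 {}/y6 {}/x4 {}/x6 in h34 h61 *.
have -> : y2 = ((x1 - x3) * (x1 + x2 + x3) - l ^+ 2 * (x1 - x2)
                + m ^+ 2 * (x3 - x2)) / (2 * (l - m)).
  have hlm : l - m != 0 by rewrite -opprB oppr_eq0.
  apply: (mulIf (mulf_neq0 two_neq0 hlm)); rewrite divfK ?mulf_neq0 //.
  by apply/eqP; rewrite -subr_eq0; apply/eqP; rewrite -[RHS](subrr (
     l * (y2 + l * (x1 - x2) + y2) - (x1 ^+ 2 + x1 * x2 + x2 ^+ 2))) {2}ha; ring.
have hlm : l - m != 0 by rewrite -opprB oppr_eq0.
by split; field; rewrite ?two_neq0 ?hml ?hlm ?h34 ?h61.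
Qed.

(** The degenerate case P3 = P1 + P2, where the outer sum is a doubling. Here [y2] is found from
    [y3 = y4], which is linear in it, instead of from two expressions for [a]. *)
Lemma assoc_formula_dbl x1 y1 x2 y2 x3 y3 l m n k a :
  y1 = y2 + l * (x1 - x2) -> y3 = y2 + m * (x3 - x2) ->
  a = l * (y1 + y2) - (x1 ^+ 2 + x1 * x2 + x2 ^+ 2) ->
  let x4 := l ^+ 2 - x1 - x2 in let y4 := l * (x1 - x4) - y1 in
  let x6 := m ^+ 2 - x2 - x3 in let y6 := m * (x2 - x6) - y2 in
  x3 = x4 -> y3 = y4 -> 2 * y4 != 0 -> x6 - x1 != 0 ->
  n = (3 * x4 ^+ 2 + a) / (2 * y4) -> k = (y6 - y1) / (x6 - x1) ->
  n ^+ 2 - x4 - x3 = k ^+ 2 - x1 - x6 /\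
  n * (x4 - (n ^+ 2 - x4 - x3)) - y4 = k * (x1 - (k ^+ 2 - x1 - x6)) - y1.
Proof.
move=> e1 e3 ea x4 y4 x6 y6 e34 e34' h4 h61 -> ->.
have e2 : y2 = - (m + l) * (x4 - x2) / 2.
  apply: (mulIf two_neq0); rewrite divfK //.
  apply/eqP; rewrite -subr_eq0; apply/eqP; rewrite -(subrr y3) {2}e34' e3 /y4 e1 e34; ring.
clear e34' e3; rewrite ea {}/y6 {}/x6 {}e34 {}/y4 {}e1 {}/x4 in h4 h61 e2 *.
rewrite {}e2 in h4 h61 *.
have h4' : l * (x1 - (l ^+ 2 - x1 - x2)) * 2 -
    (- (m + l) * (l ^+ 2 - x1 - x2 - x2) + l * (x1 - x2) * 2) != 0.
  by apply: contraNneq h4 => h; apply/eqP; rewrite -[RHS]h; field.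
by split; field; rewrite two_neq0 h4' h61.
Qed.

End Formulas.

Section GroupLaw.
Variables a b : rat.
Hypothesis ns : nonsingular a b.
Let A : algC := ratr a.
Let B : algC := ratr b.
Implicit Types x y l : algC.

Lemma nonsingularC : 4 * A ^+ 3 + 27 * B ^+ 2 != 0.
Proof.
have := ns; rewrite /nonsingular /ec_disc => h.
have -> : 4 * A ^+ 3 + 27 * B ^+ 2 = ratr (4 * a ^+ 3 + 27 * b ^+ 2).
  by rewrite rmorphD /= [ratr (4 * _)]rmorphM [ratr (27 * _)]rmorphM /= !rmorphXn /= !ratr_nat.
by rewrite fmorph_eq0.
Qed.

Lemma two_algC : 2 != 0 :> algC. Proof. by rewrite pnatr_eq0. Qed.

Lemma on_curveNy P : on_curve a b P -> on_curve a b (ec_neg P).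
Proof. by case: P => [[x y]|//] /=; rewrite sqrrN. Qed.

Lemma flex_nonsing x y : y ^+ 2 = x ^+ 3 + A * x + B -> 2 * y = 0 ->
  3 * x ^+ 2 + A != 0.
Proof.
move=> e y0; apply: contraNneq nonsingularC => h.
have {}y0 : y = 0 by apply/eqP; move/eqP: y0; rewrite mulf_eq0 (negPf two_algC).
have eA : A = - (3 * x ^+ 2) by apply/eqP; rewrite -addr_eq0 addrC h.
have eB : B = - (x ^+ 3 + A * x).
  by apply/eqP; rewrite -addr_eq0 addrC -e y0 expr0n.
by rewrite eB eA; apply/eqP; ring.
Qed.

(* The second clause says that y = y1 + l (x - x1) meets the curve at both points
   with multiplicity; for x1 = x2 it characterizes the tangent slope. *)
Definition secant x1 y1 x2 y2 l :=
  y1 = y2 + l * (x1 - x2) /\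
  A = l * (y1 + y2) - (x1 ^+ 2 + x1 * x2 + x2 ^+ 2).

Lemma secantC x1 y1 x2 y2 l : secant x1 y1 x2 y2 l -> secant x2 y2 x1 y1 l.
Proof. by case=> e1 e2; split; [rewrite e1; ring | rewrite e2; ring]. Qed.

Lemma chord_secant x1 y1 x2 y2 :
  y1 ^+ 2 = x1 ^+ 3 + A * x1 + B -> y2 ^+ 2 = x2 ^+ 3 + A * x2 + B ->
  x1 != x2 -> secant x1 y1 x2 y2 ((y2 - y1) / (x2 - x1)).
Proof.
move=> h1 h2; rewrite eq_sym -subr_eq0 => n12; split; first by field.
apply: (mulIf n12); apply/eqP; rewrite -subr_eq0; apply/eqP.
transitivity (y1 ^+ 2 - (x1 ^+ 3 + A * x1 + B) - (y2 ^+ 2 - (x2 ^+ 3 + A * x2 + B))).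
  by field.
by rewrite h1 h2; ring.
Qed.

Lemma tangent_secant x y : 2 * y != 0 ->
  secant x y x y ((3 * x ^+ 2 + A) / (2 * y)).
Proof. by move=> h; split; [ring | rewrite -[y + y]mulr2n -[y *+ 2]mulr_natl divfK //; ring]. Qed.

Definition third x1 y1 x2 l : point :=
  Some (l ^+ 2 - x1 - x2, l * (x1 - (l ^+ 2 - x1 - x2)) - y1).

Lemma ec_add_chord x1 y1 x2 y2 : x1 != x2 ->
  ec_add a (Some (x1, y1)) (Some (x2, y2)) =
  third x1 y1 x2 ((y2 - y1) / (x2 - x1)).
Proof. by move=> /negPf n; rewrite /= n. Qed.

Lemma ec_add_tangent x y : 2 * y != 0 ->
  ec_add a (Some (x, y)) (Some (x, y)) = third x y x ((3 * x ^+ 2 + A) / (2 * y)).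
Proof.
move=> h /=; rewrite eqxx -addr_eq0 -[y + y]mulr2n -[y *+ 2]mulr_natl.
by rewrite (negPf h).
Qed.

Lemma same_x x y1 y2 : y1 ^+ 2 = x ^+ 3 + A * x + B ->
  y2 ^+ 2 = x ^+ 3 + A * x + B -> y1 = y2 \/ y1 = - y2.
Proof.
by move=> e1 e2; have /eqP := etrans e1 (esym e2); rewrite eqf_sqr => /orP[]/eqP; auto.
Qed.

Variant add_spec x1 y1 x2 y2 : point -> Type :=
| AddOpp of x1 = x2 & y1 = - y2 : add_spec x1 y1 x2 y2 None
| AddSec l of secant x1 y1 x2 y2 l : add_spec x1 y1 x2 y2 (third x1 y1 x2 l).

Lemma ec_addP x1 y1 x2 y2 :
  y1 ^+ 2 = x1 ^+ 3 + A * x1 + B -> y2 ^+ 2 = x2 ^+ 3 + A * x2 + B ->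
  add_spec x1 y1 x2 y2 (ec_add a (Some (x1, y1)) (Some (x2, y2))).
Proof.
move=> e1 e2; have [e|n] := eqVneq x1 x2; last first.
  by rewrite ec_add_chord //; apply: AddSec; apply: chord_secant.
have [e'|n] := eqVneq y1 (- y2).
  by rewrite /= e e' !eqxx; apply: AddOpp.
rewrite -{x2}e in e2 *.
have ey : y1 = y2 by case: (same_x e1 e2) => // h; rewrite h eqxx in n.
rewrite -{y2}ey in n e2 *.
have y0 : 2 * y1 != 0 by move: n; rewrite -addr_eq0 -[y1 + y1]mulr2n -[y1 *+ 2]mulr_natl.
by rewrite ec_add_tangent //; apply: AddSec; apply: tangent_secant.
Qed.

Lemma third_on x1 y1 x2 y2 l : y1 ^+ 2 = x1 ^+ 3 + A * x1 + B ->
  secant x1 y1 x2 y2 l -> on_curve a b (third x1 y1 x2 l).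
Proof.
move=> e1 [e2 e3]; rewrite /= -/A -/B.
have -> : B = y1 ^+ 2 - x1 ^+ 3 - A * x1 by rewrite e1; ring.
rewrite {1}e3; have -> : y2 = y1 - l * (x1 - x2) by rewrite e2; ring.
rewrite e3; have -> : y2 = y1 - l * (x1 - x2) by rewrite e2; ring.
ring.
Qed.

Lemma ec_add_on P Q : on_curve a b P -> on_curve a b Q -> on_curve a b (ec_add a P Q).
Proof.
case: P => [[x1 y1]|] //; case: Q => [[x2 y2]|] // e1 e2.
by case: (ec_addP e1 e2) => // l; apply: third_on.
Qed.

Lemma ec_addC P Q : on_curve a b P -> on_curve a b Q -> ec_add a P Q = ec_add a Q P.
Proof.
case: P => [[x1 y1]|]; case: Q => [[x2 y2]|] // e1 e2.
have [e|n] := eqVneq x1 x2.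
  rewrite -{x2}e in e2 *; case: (same_x e1 e2) => -> //.
  by rewrite /= !eqxx opprK eqxx.
rewrite !ec_add_chord // 1?eq_sym // /third.
rewrite -subr_eq0 in n.
have n' : x2 - x1 != 0 by rewrite -opprB oppr_eq0.
by congr Some; congr pair; field; rewrite n n'.
Qed.

Lemma ec_addN P : ec_add a P (ec_neg P) = None.
Proof. by case: P => [[x y]|] //=; rewrite opprK !eqxx. Qed.

Lemma ec_negK P : ec_neg (ec_neg P) = P.
Proof. by case: P => [[x y]|] //=; rewrite opprK. Qed.

(** This instance of associativity comes first, because cancellation and the cases of [ec_addA] with
    opposite points rest on it. *)
Lemma ec_addNK P Q : on_curve a b P -> on_curve a b Q ->
  ec_add a (ec_neg P) (ec_add a P Q) = Q.
Proof.
case: P => [[x1 y1]|]; last by case: Q.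
case: Q => [[x2 y2]|] e1 e2; last by rewrite /= !eqxx.
have e1' : (- y1) ^+ 2 = x1 ^+ 3 + A * x1 + B by rewrite sqrrN.
case: (ec_addP e1 e2) => [-> ->|l hs]; first by rewrite /= opprK.
case: (hs) => [ey eA]; have on3 := third_on e1 hs.
rewrite /third /= in on3 *; set x4 := l ^+ 2 - _ - _ in on3 *.
have [e14|n14] := eqVneq x1 x4; last first.
  have n41 : x4 - x1 != 0 by rewrite subr_eq0 eq_sym.
  have -> : (l * (x1 - x4) - y1 - - y1) / (x4 - x1) = - l by field.
  congr Some; rewrite sqrrN /x4; congr pair; first by ring.
  by rewrite ey; ring.
(* Here P + Q = - P: the line through P and Q touches the curve at P, and the remaining addition
   doubles - P with slope - l. *)
have x2E : x2 = l ^+ 2 - 2 * x1 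
  by transitivity (l ^+ 2 - x1 - x4); [rewrite /x4; ring | rewrite -e14; ring].
rewrite -e14 subrr mulr0 sub0r opprK eqr_oppLR -subr_eq0 opprK -mulr2n.
have y2E : y2 = y1 - l * (x1 - x2) by rewrite ey; ring.
have flx : 3 * x1 ^+ 2 + A = 2 * y1 * l by rewrite eA y2E x2E; ring.
have [y0|y0] := eqVneq (2 * y1) 0.
  by have /eqP := flex_nonsing e1 y0; rewrite flx y0 mul0r.
have -> : (3 * x1 ^+ 2 + ratr a) / (2 * - y1) = - l.
  by rewrite -/A flx; field; move: y0; rewrite mulf_eq0 negb_or => /andP[h2 h1]; rewrite ?h1 ?h2 //.
by rewrite -mulr_natl (negPf y0); congr Some; rewrite y2E x2E; congr pair; ring.
Qed.

Lemma ec_negD P Q : ec_neg (ec_add a P Q) = ec_add a (ec_neg P) (ec_neg Q).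
Proof.
case: P => [[x1 y1]|]; case: Q => [[x2 y2]|] //.
have [e|n] := eqVneq x1 x2.
  rewrite /= e !eqxx opprK eqr_oppLR; case: eqP => // _ /=.
  rewrite mulrN invrN !mulrN sqrrN; congr Some; congr pair.
  by rewrite mulNr opprB opprK addrC.
rewrite !ec_add_chord //= /third -opprD mulNr sqrrN; congr Some.
by congr pair; ring.
Qed.

Let assoc P Q R := ec_add a (ec_add a P Q) R = ec_add a P (ec_add a Q R).

Lemma assoc_mirror P Q R : on_curve a b P -> on_curve a b Q -> on_curve a b R ->
  assoc R Q P -> assoc P Q R.
Proof.
move=> oP oQ oR; rewrite /assoc => h.
have oPQ := ec_add_on oP oQ; have oQR := ec_add_on oQ oR.
by rewrite (ec_addC oPQ oR) (ec_addC oP oQ) (ec_addC oP oQR) (ec_addC oQ oR).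
Qed.

Lemma assoc_inner_opp P Q : on_curve a b P -> on_curve a b Q -> assoc P (ec_neg P) Q.
Proof.
move=> oP oQ; rewrite /assoc ec_addN -{1}[P]ec_negK ec_addNK //.
exact: on_curveNy.
Qed.

Lemma assoc_outer_opp P Q : on_curve a b P -> on_curve a b Q ->
  assoc P Q (ec_neg (ec_add a P Q)).
Proof.
move=> oP oQ; rewrite /assoc ec_addN ec_negD.
have oNP := on_curveNy oP; have oNQ := on_curveNy oQ.
rewrite (ec_addC oNP oNQ) -{1}[Q]ec_negK ec_addNK //.
by rewrite ec_addN.
Qed.

Lemma assoc_secants x1 y1 x2 y2 x3 y3 l m x4 y4 x6 y6 :
  let P1 := Some (x1, y1) in let P2 := Some (x2, y2) in let P3 := Some (x3, y3) in
  on_curve a b P1 -> on_curve a b P2 -> on_curve a b P3 ->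
  secant x1 y1 x2 y2 l -> secant x2 y2 x3 y3 m ->
  third x1 y1 x2 l = Some (x4, y4) -> third x2 y2 x3 m = Some (x6, y6) ->
  P1 <> P3 -> x1 != x6 -> (x4 = x3 -> y4 = y3 /\ 2 * y4 != 0) ->
  ec_add a (Some (x4, y4)) P3 = ec_add a P1 (Some (x6, y6)).
Proof.
move=> P1 P2 P3 o1 o2 o3 s12 s23 e4 e6 n13 n16 h43.
have o4 := third_on o1 s12; rewrite e4 in o4.
have [e1 eA1] := s12; have [e3' eA2] := s23.
have e3 : y3 = y2 + m * (x3 - x2) by rewrite e3'; ring.
case: e4 => e4x; rewrite e4x => e4y; case: e6 => e6x; rewrite e6x => e6y.
have n61 : x6 - x1 != 0 by rewrite subr_eq0 eq_sym.
rewrite [RHS]ec_add_chord //.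
have [e43|n43] := eqVneq x4 x3; last first.
  rewrite ec_add_chord //; have n34 : x3 - x4 != 0 by rewrite subr_eq0 eq_sym.
  (* Equal slopes put the three points on one line, which forces P1 = P3 or x3 = x4; both are
     excluded. *)
  have [ml|ml] := eqVneq m l.
    exfalso.
    have : (x1 - x3) * (x3 - x4) = 0.
      rewrite -e4x.
      have := eA1; rewrite eA2 e3 e1 ml => /eqP; rewrite -subr_eq0 => /eqP h.
      by rewrite -[RHS]h; ring.
    move/eqP; rewrite mulf_eq0 (negPf n34) orbF subr_eq0 => /eqP e13.
    by apply: n13; rewrite /P1 /P3 e13 e1 e3 ml e13.
  have nml : m - l != 0 by rewrite subr_eq0.
  have [] := @assoc_formula _ two_algC x1 y1 x2 y2 x3 y3 l m _ _ A
     e1 e3 eA1 eA2 nml _ _ (erefl _) (erefl _).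
    by rewrite e4x.
    by rewrite e6x.
  by rewrite /third e4x e6x e4y e6y => -> ->.
have [e43y y40] := h43 e43.
rewrite /P3 -e43 -e43y ec_add_tangent //.
have [] := @assoc_formula_dbl _ two_algC x1 y1 x2 y2 x3 y3 l m _ _ A
     e1 e3 eA1 _ _ _ _ (erefl _) (erefl _).
- by rewrite e4x.
- by rewrite e4x e4y e43y.
- by rewrite e4x e4y.
- by rewrite e6x.
by rewrite /third e4x e6x e4y e6y -e43 => -> ->.
Qed.

Lemma thirdC x1 y1 x2 y2 l : secant x1 y1 x2 y2 l ->
  third x1 y1 x2 l = third x2 y2 x1 l.
Proof. by case=> e _; rewrite /third e; congr Some; congr pair; ring. Qed.

Lemma ec_addI P Q R : on_curve a b P -> on_curve a b Q -> on_curve a b R ->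
  ec_add a P Q = ec_add a P R -> Q = R.
Proof. by move=> oP oQ oR e; rewrite -(ec_addNK oP oQ) e ec_addNK. Qed.

(* The one case that no secant formula covers: translation by a 2-torsion point
   does not change the double of a point. *)
Lemma assoc_dbl2 x1 y1 x2 x4 y4 :
  let P := Some (x1, y1) in let T := Some (x2, 0) in
  on_curve a b P -> on_curve a b T -> ec_add a P T = Some (x4, y4) ->
  x1 != x2 -> 2 * y1 != 0 -> 2 * y4 != 0 ->
  ec_add a P P = ec_add a (Some (x4, y4)) (Some (x4, y4)).
Proof.
move=> P T o1 o2 e4 n12 y1n y4n.
have [e1 eA] := chord_secant o1 o2 n12.
rewrite (ec_add_chord _ _ n12) in e4; move: e4; rewrite /third; set l := _ / _ in e1 eA *.
move=> [x4E y4E]; rewrite !ec_add_tangent // /third.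
have x12 : x1 - x2 != 0 by rewrite subr_eq0.
have ln : l != 0 by apply: contraNneq y1n; rewrite e1 => ->; rewrite mul0r addr0 mulr0.
have y1E : y1 = l * (x1 - x2) by rewrite {1}e1 add0r.
have fA : A = l ^+ 2 * (x1 - x2) - (x1 ^+ 2 + x1 * x2 + x2 ^+ 2).
  by rewrite {1}eA {1}y1E; ring.
have y4F : y4 = l * (2 * x1 + x2 - l ^+ 2 - (x1 - x2)).
  by rewrite -y4E y1E; ring.
have nx : 2 * x1 + x2 - l ^+ 2 - (x1 - x2) != 0.
  by apply: contraNneq y4n => h; rewrite y4F h !mulr0.
rewrite -/A fA y4F -x4E y1E.
by congr Some; congr pair; field; rewrite nx ln.
Qed.

Lemma ec_addA P Q R : on_curve a b P -> on_curve a b Q -> on_curve a b R ->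
  ec_add a (ec_add a P Q) R = ec_add a P (ec_add a Q R).
Proof.
have Nchar x : (2 * x == 0) = (x == - x) by rewrite -addr_eq0 -mulr2n -[x *+ 2]mulr_natl.
move=> oP oQ oR; rewrite -/(assoc P Q R).
have [->|nPR] := eqVneq P R; first by 
  by rewrite /assoc (ec_addC oR oQ) [RHS]ec_addC //; apply: ec_add_on.
have [e|nPQ] := eqVneq Q (ec_neg P); first by rewrite e; exact: assoc_inner_opp.
have [e|nQR] := eqVneq Q (ec_neg R).
  by apply: assoc_mirror => //; rewrite e; apply: assoc_inner_opp.
have [e|n4] := eqVneq R (ec_neg (ec_add a P Q)).
  by rewrite e; apply: assoc_outer_opp.
have [e|n6] := eqVneq P (ec_neg (ec_add a Q R)).
  by apply: assoc_mirror => //; rewrite e (ec_addC oQ oR); apply: assoc_outer_opp.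
case: P Q R oP oQ oR nPR nPQ nQR n4 n6 => [[x1 y1]|] [[x2 y2]|] [[x3 y3]|] // o1 o2 o3;
  rewrite /assoc //; last first.
  by move=> _ _ _ _ _; rewrite [ec_add a (Some (x2, y2)) None]/=; case: (ec_add a (Some (x1, y1)) (Some (x2, y2))) => [[]|].
move: (ec_addP o1 o2) (ec_addP o2 o3).
move E12 : (ec_add a (Some (x1, y1)) (Some (x2, y2))) => S12 sp12.
move E23 : (ec_add a (Some (x2, y2)) (Some (x3, y3))) => S23 sp23.
case: sp12 E12 => [-> -> _|l s12 E12]; first by rewrite /= opprK eqxx.
case: sp23 E23 => [-> -> _|m s23 E23]; first by rewrite /= eqxx.
have o4 := third_on o1 s12; have o6 := third_on o2 s23.
case e4 : (third x1 y1 x2 l) o4 E12 => [[x4 y4]|] // o4 E12.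
case e6 : (third x2 y2 x3 m) o6 E23 => [[x6 y6]|] // o6 E23.
move=> /eqP n13 _ _ n34 n16.
have h43 : x4 = x3 -> y4 = y3 /\ 2 * y4 != 0.
  move=> e43; rewrite e43 in o4; have [ey|ey] := same_x o4 o3; last first.
    by case/eqP: n34; rewrite e43 ey /= opprK.
  split=> //; rewrite Nchar; apply: contraNneq n34 => h.
  by rewrite /= e43 -h ey.
have h61 : x6 = x1 -> y6 = y1 /\ 2 * y6 != 0.
  move=> e61; rewrite e61 in o6; have [ey|ey] := same_x o6 o1; last first.
    by case/eqP: n16; rewrite e61 ey /= opprK.
  split=> //; rewrite Nchar; apply: contraNneq n16 => h.
  by rewrite /= e61 -h ey.
have [e16|n16'] := eqVneq x1 x6; last first.
  exact: (assoc_secants o1 o2 o3 s12 s23 e4 e6).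
(* [assoc_secants] admits a tangent on the left side only; a tangent on the right side alone is its
   mirror image. *)
have [e43|n43] := eqVneq x4 x3; last first.
  have e4' : third x2 y2 x1 l = Some (x4, y4) by rewrite (thirdC (secantC s12)).
  have e6' : third x3 y3 x2 m = Some (x6, y6) by rewrite (thirdC (secantC s23)).
  rewrite [LHS]ec_addC // [RHS]ec_addC //; apply/esym.
  apply: (assoc_secants o3 o2 o1 (secantC s23) (secantC s12) e6' e4') => //.
    by move=> e; case: n13.
  by rewrite eq_sym.
have [ey4 y4n] := h43 e43; have [ey6 y6n] := h61 (esym e16).
rewrite -e16 ey6 e43 ey4 in y6n E12 E23 *.
(* Now P + Q = R and Q + R = P, so Q has order 2. *)
have : ec_neg (Some (x2, y2)) = Some (x2, y2).
  apply: (@ec_addI (Some (x1, y1))) => //; first exact: on_curveNy.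
  have := ec_addNK o2 o3; rewrite E23 E12 => <-.
  by rewrite ec_addC //; apply: on_curveNy.
case=> e2; have y20 : y2 = 0.
  by apply/eqP; have := Nchar y2; rewrite e2 eqxx mulf_eq0 (negPf two_algC).
rewrite y20 in o2 E12 E23 *.
apply/esym; apply: (assoc_dbl2 o1 o2) => //.
  apply: contraNneq y6n => e12; rewrite -e12 in o2.
  by have [->|->] := same_x o1 o2; rewrite ?oppr0 mulr0.
by rewrite -ey4.
Qed.

End GroupLaw.

(** * The abelian group of points *)

Definition on_curveb (a b : rat) (P : point) : bool :=
  if P is Some (x, y) then y ^+ 2 == x ^+ 3 + ratr a * x + ratr b else true.

Lemma on_curveP a b P : reflect (on_curve a b P) (on_curveb a b P).
Proof. by case: P => [[x y]|] /=; [apply: eqP | constructor]. Qed.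

(** With a boolean condition two points are equal as soon as their coordinates are, and the type
    inherits equality and choice. *)
Record ecpt a b (ns : nonsingular a b) :=
  EcPt { ecval :> point; ecvalP : on_curveb a b ecval }.

HB.instance Definition _ a b (ns : nonsingular a b) := [isSub for @ecval a b ns].
HB.instance Definition _ a b (ns : nonsingular a b) := [Choice of ecpt ns by <:].

Section EcZmod.
Variables (a b : rat) (ns : nonsingular a b).
Implicit Types P Q R : ecpt ns.

Lemma ecptP P : on_curve a b P. Proof. exact/on_curveP/ecvalP. Qed.

Definition mkpt (P : point) (h : on_curve a b P) : ecpt ns :=
  EcPt ns (introT (on_curveP a b P) h).

Definition ecpt0 : ecpt ns := @mkpt None I.
Definition ecptD P Q : ecpt ns := mkpt (ec_add_on (ecptP P) (ecptP Q)).
Definition ecptN P : ecpt ns := mkpt (on_curveNy (ecptP P)).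

Lemma ecptA : associative ecptD.
Proof.
move=> P Q R; apply: val_inj => /=.
by rewrite (ec_addA ns) //; apply: ecptP.
Qed.

Lemma ecptC : commutative ecptD.
Proof. by move=> P Q; apply: val_inj => /=; apply: (ec_addC (ecptP P) (ecptP Q)). Qed.

Lemma ecpt0D : left_id ecpt0 ecptD.
Proof. by move=> P; apply: val_inj. Qed.

Lemma ecptND : left_inverse ecpt0 ecptN ecptD.
Proof. by move=> P; rewrite ecptC; apply: val_inj; apply: ec_addN. Qed.

HB.instance Definition _ := GRing.isZmodule.Build (ecpt ns) ecptA ecptC ecpt0D ecptND.

Lemma val_ecptD P Q : ecval (P + Q) = ec_add a P Q. Proof. by []. Qed.
Lemma val_ecptN P : ecval (- P) = ec_neg P. Proof. by []. Qed.

Lemma val_ecptMn P n : iter n (ec_add a P) None = ecval (P *+ n).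
Proof. by elim: n => // n IH; rewrite iterS IH mulrS. Qed.

Lemma val_ecptMz P c : ec_mul a c P = ecval (P *~ c).
Proof.
case: c => n; first exact: val_ecptMn.
by rewrite NegzE mulrNz val_ecptN -val_ecptMn.
Qed.

Lemma val_ecpt_sum (I : Type) (s : seq I) (P : I -> ecpt ns) (c : I -> int) :
  foldr (ec_add a) None [seq ec_mul a (c i) (P i) | i <- s] =
  ecval (\sum_(i <- s) P i *~ c i).
Proof.
elim: s => [|i s IH]; first by rewrite big_nil.
by rewrite big_cons /= IH val_ecptMz.
Qed.

End EcZmod.

(** * Independence and spans in abelian groups *)

Definition indep (V : zmodType) n (P : 'I_n -> V) :=
  forall c : 'I_n -> int, \sum_i P i *~ c i = 0 -> forall i, c i = 0.

Lemma rank_geP a b (ns : nonsingular a b) K n : rank_ge a b K n <->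
  exists P : 'I_n -> ecpt ns, (forall i, coords_in K (P i)) /\ indep P.
Proof.
split=> [[P [oP KP iP]]|[P [KP iP]]].
  exists (fun i => mkpt ns (oP i)); split=> // c c0; apply: iP.
  by have := val_ecpt_sum (enum 'I_n) (fun i => mkpt ns (oP i)) c; rewrite big_enum c0.
exists (fun i => ecval (P i)); split=> //; first by move=> i; apply: ecptP.
move=> c c0; apply: iP; apply: val_inj.
by have := val_ecpt_sum (enum 'I_n) P c; rewrite big_enum c0.
Qed.

Definition in_span (V : zmodType) (S : seq V) (x : V) :=
  exists c : 'I_(size S) -> int, x = \sum_(i < size S) S`_i *~ c i.

Lemma in_spanD (V : zmodType) (S : seq V) x y : in_span S x -> in_span S y -> in_span S (x + y).
Proof.
case=> c -> [d ->]; exists (fun i => c i + d i).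
by rewrite -big_split; apply: eq_bigr => i _; rewrite mulrzDr.
Qed.

Lemma in_spanN (V : zmodType) (S : seq V) x : in_span S x -> in_span S (- x).
Proof.
case=> c ->; exists (fun i => - c i).
by rewrite -sumrN; apply: eq_bigr => i _; rewrite mulrNz.
Qed.

Lemma mem_in_span (V : zmodType) (S : seq V) x : x \in S -> in_span S x.
Proof.
move=> /(nthP 0)[i lti <-]; exists (fun j => (j == Ordinal lti)%:Z).
rewrite (bigD1 (Ordinal lti)) //= eqxx big1 ?addr0 // => j /negPf->.
by rewrite mulr0z.
Qed.

Lemma int_kernel n s (M : 'I_n -> 'I_s -> int) : (s < n)%N ->
  exists c : 'I_n -> int, (exists i, c i != 0) /\ forall j, \sum_i c i * M i j = 0.
Proof.
move=> ltsn; pose A : 'M[rat]_(n, s) := \matrix_(i, j) (M i j)%:~R.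
have: kermx A != 0.
  rewrite -mxrank_eq0 mxrank_ker subn_eq0 -ltnNge.
  exact: leq_ltn_trans (rank_leq_col A) ltsn.
move=> /rowV0Pn[v /sub_kermxP vA vn0].
have [i0 vi0] : exists i, v 0 i != 0.
  apply/existsP; apply: contraR vn0 => /existsPn h.
  by apply/eqP/rowP => i; rewrite mxE; apply/eqP; have := h i; rewrite negbK.
(* A common denominator makes the rational kernel vector integral. *)
pose d := \prod_i denq (v 0 i).
have dn0 : d != 0 by apply/prodf_neq0 => i _; rewrite denq_eq0.
pose c i := numq (v 0 i) * \prod_(k | k != i) denq (v 0 k).
have cE i : (c i)%:~R = d%:~R * v 0 i.
  rewrite /d (bigD1 i) //= /c [RHS]mulrC -{2}(divq_num_den (v 0 i)) !rmorphM /=.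
  have h : (denq (v 0 i))%:~R != 0 :> rat by rewrite intr_eq0 denq_eq0.
  by rewrite mulrA divfK.
exists c; split.
  by exists i0; rewrite -(intr_eq0 rat) cE mulf_neq0 ?intr_eq0.
move=> j; apply/eqP; rewrite -(intr_eq0 rat) rmorph_sum /=; apply/eqP.
transitivity (d%:~R * (v *m A) 0 j); last by rewrite vA mxE mulr0.
rewrite mxE mulr_sumr; apply: eq_bigr => i _.
by rewrite rmorphM /= cE mxE mulrA.
Qed.

(** With more points than generators, the coefficient equations have a nonzero integral solution;
    torsion among the generators does no harm. *)
Lemma indep_in_span (V : zmodType) (S : seq V) n (P : 'I_n -> V) :
  (forall i, in_span S (P i)) -> indep P -> (n <= size S)%N.
Proof.
move=> /fin_all_exists[M PM] iP; rewrite leqNgt; apply/negP => /(int_kernel M)[c [[i ci] cM]].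
case/eqP: ci; apply: iP; under eq_bigr do rewrite PM mulrz_suml; rewrite exchange_big /=.
rewrite big1 // => j _; rewrite -[RHS](mulr0z S`_j) -(cM j) mulrz_sumr.
by apply: eq_bigr => k _; rewrite mulrC mulrzA.
Qed.

(** * Heights *)

Definition height (x : rat) : nat := maxn `|numq x|%N `|denq x|%N.

Lemma height_gt0 x : (0 < height x)%N.
Proof. by rewrite leq_max orbC absz_gt0 denq_eq0. Qed.

Lemma numq_le_height x : `|numq x| <= (height x)%:Z.
Proof. by rewrite -abszE lez_nat leq_maxl. Qed.

Lemma denq_le_height x : `|denq x| <= (height x)%:Z.
Proof. by rewrite -abszE lez_nat leq_maxr. Qed.

Lemma height_frac_le (p q : int) (M : nat) : q != 0 ->
  `|p| <= M%:Z -> `|q| <= M%:Z -> (height (p%:~R / q%:~R) <= M)%N.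
Proof.
case: divqP => [|k x kn0]; first by rewrite eqxx.
rewrite mulf_eq0 => /norP[_ _]; rewrite -!abszE !lez_nat !abszM => hp hq.
have k1 : (0 < `|k|)%N by rewrite absz_gt0.
rewrite geq_max; apply/andP; split.
  by apply: leq_trans hp; rewrite leq_pmull.
by apply: leq_trans hq; rewrite leq_pmull.
Qed.

Lemma northcott (H : nat) : exists S : seq rat, forall x, (height x <= H)%N -> x \in S.
Proof.
exists [seq (i.1%:Z - i.2%:Z)%:~R / (j%:Z)%:~R
  | i <- [seq (k, l) | k <- iota 0 H.+1, l <- iota 0 H.+1], j <- iota 0 H.+1] => x.
have mi k : (k <= H)%N -> k \in iota 0 H.+1 by rewrite mem_iota.
rewrite geq_max => /andP[hn hd].
rewrite -[x]divq_num_den.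
case E : (numq x) hn => [n|n] hn; have [d dE] := denqP x; rewrite dE absz_nat in hd *.
  apply/allpairsPdep; exists (n, 0%N), d.+1; split; [|exact: mi|by rewrite subr0].
  by apply/allpairsPdep; exists n, 0%N; split=> //; apply: mi.
apply/allpairsPdep; exists (0%N, n.+1), d.+1; split; [|exact: mi|by rewrite sub0r].
by apply/allpairsPdep; exists 0%N, n.+1; split=> //; apply: mi.
Qed.

Definition form (c : seq int) (m z : int) : int :=
  \sum_(i < size c) c`_i * m ^+ ((size c).-1 - i) * z ^+ i.

Definition form_norm (c : seq int) : nat := \sum_(i < size c) `|(c`_i)%R|%N.

Lemma form_le c m z (H : nat) : `|m| <= H%:Z -> `|z| <= H%:Z ->
  `|form c m z| <= (form_norm c)%:Z * H%:Z ^+ (size c).-1.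
Proof.
move=> hm hz; apply: le_trans (ler_norm_sum _ _ _) _.
rewrite /form_norm -natz natr_sum mulr_suml; apply: ler_sum => i _.
rewrite !normrM !normrX natz abszE -mulrA ler_wpM2l //.
have -> : H%:Z ^+ (size c).-1 = H%:Z ^+ ((size c).-1 - i) * H%:Z ^+ i.
  by rewrite -exprD subnK //; case: (size c) i => [[]|s i] //; rewrite -ltnS ltn_ord.
by rewrite ler_pM ?exprn_ge0 // lerXn2r // ?nnegrE // (le_trans _ hm).
Qed.

Lemma sqr_rat_int (q : rat) (n : int) : q ^+ 2 = n%:~R -> exists m : int, q = m%:~R.
Proof.
move=> qn; exists (numq q).
have e : numq q ^+ 2 = n * denq q ^+ 2.
  by apply: (@intr_inj rat); rewrite rmorphXn /= rmorphM rmorphXn /= numqE exprMn qn.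
have : (denq q %| numq q)%Z by rewrite -(@dvdz_pexp2r _ _ 2) // e dvdz_mull.
rewrite dvdzE => /gcdn_idPr; have /eqP -> := coprime_num_den q => d1.
by rewrite numqE -[denq q]absz_denq -d1 mulr1.
Qed.

(* The duplication formula is x |-> F(m, z) / G(m, z) for x = m / z. The resultant
   identities below bound both the common factor of F and G and, from below,
   their size, hence the height of the double. *)
Section Duplication.
Variables A B : int.
Let D := 4 * A ^+ 3 + 27 * B ^+ 2.
Hypothesis Dn0 : D != 0.

Let F m z : int := (m ^+ 2 - A * z ^+ 2) ^+ 2 - 8 * B * m * z ^+ 3.
Let G m z : int := 4 * z * (m ^+ 3 + A * m * z ^+ 2 + B * z ^+ 3).
Let f1 m z : int := 12 * m ^+ 2 * z + 16 * A * z ^+ 3.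
Let g1 m z : int := 3 * m ^+ 3 - 5 * A * m * z ^+ 2 - 27 * B * z ^+ 3.
Let f2 m z : int := 4 * D * m ^+ 3 - 4 * A ^+ 2 * B * m ^+ 2 * z
  + 4 * A * (3 * A ^+ 3 + 22 * B ^+ 2) * m * z ^+ 2 + 12 * B * (A ^+ 3 + 8 * B ^+ 2) * z ^+ 3.
Let g2 m z : int := A ^+ 2 * B * m ^+ 3 + A * (5 * A ^+ 3 + 32 * B ^+ 2) * m ^+ 2 * z
  + 2 * B * (13 * A ^+ 3 + 96 * B ^+ 2) * m * z ^+ 2 - 3 * A ^+ 2 * (A ^+ 3 + 8 * B ^+ 2) * z ^+ 3.

Lemma dup_resultant1 m z : f1 m z * F m z - g1 m z * G m z = 4 * D * z ^+ 7.
Proof. rewrite /f1 /F /g1 /G /D; ring. Qed.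

Lemma dup_resultant2 m z : f2 m z * F m z + g2 m z * G m z = 4 * D * m ^+ 7.
Proof. rewrite /f2 /F /g2 /G /D; ring. Qed.

Lemma height_dup : exists C : nat, forall x : rat, x ^+ 3 + A%:~R * x + B%:~R != 0 ->
  (height x ^ 4 <= C * height (((x ^+ 2 - A%:~R) ^+ 2 - 8 * B%:~R * x)
                               / (4 * (x ^+ 3 + A%:~R * x + B%:~R))))%N.
Proof.
pose c1 := [:: 0; 12; 0; 16 * A]; pose d1 := [:: 3; 0; - 5 * A; - 27 * B].
pose c2 := [:: 4 * D; - 4 * A ^+ 2 * B; 4 * A * (3 * A ^+ 3 + 22 * B ^+ 2);
               12 * B * (A ^+ 3 + 8 * B ^+ 2)].
pose d2 := [:: A ^+ 2 * B; A * (5 * A ^+ 3 + 32 * B ^+ 2);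
               2 * B * (13 * A ^+ 3 + 96 * B ^+ 2); - 3 * A ^+ 2 * (A ^+ 3 + 8 * B ^+ 2)].
have E1 m z : f1 m z = form c1 m z by rewrite /form !big_ord_recl big_ord0 /= /f1; ring.
have E2 m z : f2 m z = form c2 m z by rewrite /form !big_ord_recl big_ord0 /= /f2; ring.
have E3 m z : g1 m z = form d1 m z by rewrite /form !big_ord_recl big_ord0 /= /g1; ring.
have E4 m z : g2 m z = form d2 m z by rewrite /form !big_ord_recl big_ord0 /= /g2; ring.
pose C1 := (form_norm c1 + form_norm d1)%N; pose C2 := (form_norm c2 + form_norm d2)%N.
exists (C1 + C2)%N => x fn0.
set X := _ / _; pose m := numq x; pose z := denq x.
have zn0 : z%:~R != 0 :> rat by rewrite intr_eq0 denq_eq0.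
have xE : x = m%:~R / z%:~R by rewrite divq_num_den.
have fn0' : m%:~R ^+ 3 + A%:~R * m%:~R * z%:~R ^+ 2 + B%:~R * z%:~R ^+ 3 != 0 :> rat.
  apply: contraNneq fn0 => h.
  by apply/eqP/(mulIf (expf_neq0 3 zn0)); rewrite mul0r -h xE; field.
have XE : X = (F m z)%:~R / (G m z)%:~R.
  rewrite /X /F /G xE.
  by field; rewrite fn0' zn0.
have Gn0 : G m z != 0.
  rewrite !mulf_neq0 // ?denq_eq0 //.
  by rewrite -(intr_eq0 rat); apply: contraNneq fn0' => <-; apply/eqP; ring.
move: XE Gn0 (dup_resultant1 m z) (dup_resultant2 m z).
move: (F m z) (G m z) => Fm Gm; case: divqP => [|k _Y kn0]; first by rewrite eqxx.
move=> <-; rewrite mulf_eq0 => /norP[_ _] r1 r2.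
(* [k] is the factor that cancels in F / G. It divides both [4 D z^7] and [4 D m^7], and [z^7] and
   [m^7] are coprime. *)
have kd : (k %| 4 * D)%Z.
  have dv (w u v : int) : u * (k * numq X) + v * (k * denq X) = 4 * D * w ^+ 7 ->
      (k %| 4 * D * w ^+ 7)%Z.
    move=> <-; apply/dvdzP; exists (u * numq X + v * denq X); ring.
  have d1' : (k %| 4 * D * z ^+ 7)%Z by apply: (dv z (f1 m z) (- g1 m z)); rewrite -r1; ring.
  have d2' : (k %| 4 * D * m ^+ 7)%Z by apply: (dv m (f2 m z) (g2 m z)); rewrite -r2.
  have /coprimezP[[u v] /= uv] : coprimez (m ^+ 7) (z ^+ 7).
    by rewrite coprimezXl // coprimezXr // coprimezE coprime_num_den.
  have -> : 4 * D = u * (4 * D * m ^+ 7) + v * (4 * D * z ^+ 7).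
    by transitivity (4 * D * (u * m ^+ 7 + v * z ^+ 7)); [rewrite uv mulr1 | ring].
  by rewrite rpredD // dvdz_mull.
have kle : `|k| <= `|4 * D|.
  by rewrite -!abszE lez_nat dvdn_leq // absz_gt0 mulf_neq0.
have [hm hz] := (numq_le_height x, denq_le_height x).
have hX := (numq_le_height X, denq_le_height X).
have H0 := height_gt0 x.
set H := height x in hm hz H0 *; set M := height X in hX *.
(* Since [|k| <= |4 D|], the cancelled factor is absorbed by [4 D]. The cubic cofactors cost [H^3]
   out of [H^7], which leaves the exponent 4. *)
have key w c d : size c = 4%N -> size d = 4%N ->
   form c m z * (k * numq X) + form d m z * (k * denq X) = 4 * D * w ^+ 7 ->
   `|w| ^+ 7 <= (form_norm c + form_norm d)%:Z * H%:Z ^+ 3 * M%:Z.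
  move=> sc sd e; have D4 : 0 < `|4 * D| by rewrite normr_gt0 mulf_neq0.
  rewrite -(ler_pM2l D4) -normrX -normrM -e; apply: le_trans (ler_normD _ _) _.
  have := form_le c hm hz; have := form_le d hm hz; rewrite sc sd /= => hd hc.
  have -> : (form_norm c + form_norm d)%:Z * H%:Z ^+ 3 * M%:Z =
    (form_norm c)%:Z * H%:Z ^+ 3 * M%:Z + (form_norm d)%:Z * H%:Z ^+ 3 * M%:Z.
    by rewrite PoszD !mulrDl.
  rewrite [leRHS]mulrDr (normrM (form c m z)) (normrM (form d m z)) !(normrM k).
  have bd u v C : `|u| <= C%:Z * H%:Z ^+ 3 -> `|v| <= M%:Z ->
      `|u| * (`|k| * `|v|) <= `|4 * D| * (C%:Z * H%:Z ^+ 3 * M%:Z).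
    by move=> hu hv; rewrite mulrCA ler_pM ?mulr_ge0 // ler_pM.
  by rewrite lerD // bd //; apply hX.
have k1 : `|z| ^+ 7 <= (C1 + C2)%:Z * H%:Z ^+ 3 * M%:Z.
  apply: le_trans (key z c1 [seq - i | i <- d1] _ _ _) _ => //.
    rewrite -r1 -E1; congr (_ + _); rewrite -mulNr; congr (_ * _).
    by rewrite E3 /form !big_ord_recl !big_ord0 /=; ring.
  have -> : form_norm [seq - i | i <- d1] = form_norm d1.
    by rewrite /form_norm !big_ord_recl !big_ord0 /= !abszN.
  by rewrite !PoszD !ler_wpM2r // -!PoszD lez_nat leq_addr.
have k2 : `|m| ^+ 7 <= (C1 + C2)%:Z * H%:Z ^+ 3 * M%:Z.
  apply: le_trans (key m c2 d2 _ _ _) _ => //.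
    by rewrite -E2 -E4.
  by rewrite !PoszD !ler_wpM2r // -!PoszD lez_nat leq_addl.
have : H%:Z ^+ 7 <= (C1 + C2)%:Z * H%:Z ^+ 3 * M%:Z.
  rewrite {1}/H /height; case: leqP => _; rewrite abszE //.
have -> : H%:Z ^+ 7 = H%:Z ^+ 3 * H%:Z ^+ 4 by rewrite -exprD.
have -> : (C1 + C2)%:Z * H%:Z ^+ 3 * M%:Z = H%:Z ^+ 3 * ((C1 + C2)%:Z * M%:Z) by ring.
by rewrite ler_pM2l ?exprn_gt0.
Qed.

End Duplication.

Section Translation.
Variables A B : int.

(** Comparing coprime parts in the cleared equation gives [q^2 = z^3] for the denominators [q] of
    [y] and [z] of [x]. So [q / z] has square [z], and is an integer. *)
Lemma point_denq (x y : rat) : y ^+ 2 = x ^+ 3 + A%:~R * x + B%:~R ->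
  exists n d : int, [/\ d != 0, denq x = d ^+ 2 & y = n%:~R / d%:~R ^+ 3].
Proof.
move=> e; pose m := numq x; pose z := denq x; pose p := numq y; pose q := denq y.
have zn0 : z != 0 by rewrite denq_eq0.
have qn0 : q != 0 by rewrite denq_eq0.
have zn0' : z%:~R != 0 :> rat by rewrite intr_eq0.
have qn0' : q%:~R != 0 :> rat by rewrite intr_eq0.
pose w := m ^+ 3 + A * m * z ^+ 2 + B * z ^+ 3.
have e1 : p ^+ 2 * z ^+ 3 = w * q ^+ 2.
  apply: (@intr_inj rat); apply/eqP; rewrite -subr_eq0; apply/eqP.
  have [xE yE] : x = m%:~R / z%:~R /\ y = p%:~R / q%:~R by rewrite !divq_num_den.
  transitivity ((y ^+ 2 - (x ^+ 3 + A%:~R * x + B%:~R)) * q%:~R ^+ 2 * z%:~R ^+ 3).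
    by rewrite /w xE yE; field; rewrite qn0' zn0'.
  by rewrite e subrr !mul0r.
have copq : coprimez (q ^+ 2) (p ^+ 2).
  by rewrite coprimezXl // coprimezXr // coprimezE coprime_sym coprime_num_den.
have cozw : coprimez (z ^+ 3) w.
  have coz : coprimez z (m ^+ 3) by rewrite coprimezXr // coprimezE coprime_sym coprime_num_den.
  rewrite coprimezXl // /coprimez /w.
  have -> : m ^+ 3 + A * m * z ^+ 2 + B * z ^+ 3 = (A * m * z + B * z ^+ 2) * z + m ^+ 3.
    by ring.
  by rewrite gcdzMDl.
have qz : q ^+ 2 = z ^+ 3.
  apply/eqP; rewrite -[q ^+ 2]ger0_norm ?exprn_ge0 // ?(ltW (denq_gt0 _)) //.
  rewrite -[z ^+ 3]ger0_norm ?exprn_ge0 // ?(ltW (denq_gt0 _)) //.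
  rewrite -!abszE eqz_nat eqn_dvd -!dvdzE.
  rewrite -(Gauss_dvdzr _ copq) e1 dvdz_mull //=.
  by rewrite -(Gauss_dvdzr _ cozw) -e1 dvdz_mull.
have [d dE] : exists d : int, q%:~R / z%:~R = d%:~R :> rat.
  apply: (@sqr_rat_int _ z).
  have qz' : q%:~R ^+ 2 = z%:~R ^+ 3 :> rat 
    by have := congr1 (intr : int -> rat) qz; rewrite !rmorphXn.
  by rewrite exprMn qz'; field.
have qE : q = d * z by apply: (@intr_inj rat); rewrite rmorphM /= -dE divfK.
have zE : z = d ^+ 2.
  apply: (mulIf (expf_neq0 2 zn0)); rewrite -exprMn -qE qz; ring.
have dn0 : d != 0 by apply: contraNneq zn0 => d0; rewrite zE d0.
exists p, d; split=> //.
by rewrite -{1}[y]divq_num_den -/p -/q qE zE -exprS rmorphXn.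
Qed.

(** The new abscissa is [((x r + A) (x + r) + 2 B - 2 y s) / (x - r)^2]. With [x = m / d^2] and
    [y = n / d^3], every term becomes a quadratic form in [m] and [d^2], except that of [y], which
    becomes [n d]; the square of [n d] is a quartic form. *)
Lemma height_translate (r s : rat) : s ^+ 2 = r ^+ 3 + A%:~R * r + B%:~R ->
  exists C : nat, forall x y : rat, y ^+ 2 = x ^+ 3 + A%:~R * x + B%:~R -> x != r ->
  (height (((s - y) / (r - x)) ^+ 2 - x - r) <= C * height x ^ 2)%N.
Proof.
move=> es.
pose t := denq r * denq s; pose r1 := numq r * denq s; pose s1 := numq s * denq r.
have tn0 : t%:~R != 0 :> rat by rewrite intr_eq0 mulf_neq0 ?denq_eq0.
have rE : r = r1%:~R / t%:~R.
  rewrite -{1}[r]divq_num_den /r1 /t; field.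
  by rewrite !intr_eq0 !denq_eq0.
have sE : s = s1%:~R / t%:~R.
  rewrite -{1}[s]divq_num_den /s1 /t; field.
  by rewrite !intr_eq0 !denq_eq0.
pose c0 := [:: 0; 1; 0; A; B].
pose c1 := [:: r1 * t; r1 ^+ 2 + A * t ^+ 2; A * t * r1 + 2 * B * t ^+ 2].
pose c2 := [:: t ^+ 2; - 2 * t * r1; r1 ^+ 2].
pose C := (form_norm c1 + 2 * `|(s1 * t)%R| * form_norm c0 + form_norm c2)%N.
exists C => x y e nxr.
have [n [d [dn0 zE yE]]] := point_denq e.
pose m := numq x; pose z := denq x.
have dn0' : d%:~R != 0 :> rat by rewrite intr_eq0.
have xE : x = m%:~R / d%:~R ^+ 2 by rewrite -rmorphXn -zE divq_num_den.
have {}zE : z = d ^+ 2 := zE.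
have [hm hz] := (numq_le_height x, denq_le_height x).
set H := height x in hm hz *.
have nd2 : (n * d) ^+ 2 = form c0 m z.
  apply: (@intr_inj rat); rewrite /form !big_ord_recl big_ord0 /= /bump /= zE.
  have nE : n%:~R = y * d%:~R ^+ 3 :> rat by rewrite yE divfK ?expf_neq0.
  apply/eqP; rewrite -subr_eq0; apply/eqP.
  transitivity ((y ^+ 2 - (x ^+ 3 + A%:~R * x + B%:~R)) * d%:~R ^+ 8); last first.
    by rewrite e subrr mul0r.
  by rewrite rmorphXn rmorphM /= nE xE; field.
have ndle : `|n * d| <= (form_norm c0)%:Z * H%:Z ^+ 2.
  rewrite -(@ler_pXn2r _ 2) ?nnegrE ?mulr_ge0 ?exprn_ge0 //.
  rewrite -normrX nd2; apply: le_trans (form_le c0 hm hz) _.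
  rewrite exprMn -exprM ler_wpM2r ?exprn_ge0 //.
  by case: (form_norm c0) => // k; rewrite expr2 -PoszM lez_nat leq_pmulr.
pose num := form c1 m z - 2 * (s1 * t) * (n * d).
pose den := form c2 m z.
have denE : den = (m * t - r1 * z) ^+ 2.
  by rewrite /den /form !big_ord_recl big_ord0 /= /bump /=; ring.
have den0 : m%:~R * t%:~R - r1%:~R * d%:~R ^+ 2 != 0 :> rat.
  apply: contraNneq nxr => h; apply/eqP; rewrite xE rE.
  apply/eqP; rewrite eqr_div ?expf_neq0 // -subr_eq0 -h; apply/eqP; ring.
have den0' : m * t - r1 * z != 0.
  rewrite -(intr_eq0 rat) zE; apply: contraNneq den0 => <-; apply/eqP; ring.
have -> : ((s - y) / (r - x)) ^+ 2 - x - r = num%:~R / den%:~R.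
  transitivity (((x * r + A%:~R) * (x + r) + 2 * B%:~R - 2 * y * s) / (x - r) ^+ 2).
    have xr0 : x - r != 0 by rewrite subr_eq0.
    have rx0 : r - x != 0 by rewrite -opprB oppr_eq0.
    have -> : ((s - y) / (r - x)) ^+ 2 = (s ^+ 2 + y ^+ 2 - 2 * s * y) / (r - x) ^+ 2.
      by field.
    by rewrite es e; field; rewrite xr0 rx0.
  rewrite denE /num /form !big_ord_recl big_ord0 /= /bump /= zE xE yE rE sE.
  by field; rewrite dn0' tn0 den0.
have nneg (k : nat) : 0 <= k%:Z * H%:Z ^+ 2 by rewrite mulr_ge0 ?exprn_ge0.
have hnum : `|num| <= (form_norm c1 + 2 * `|(s1 * t)%R| * form_norm c0)%:Z * H%:Z ^+ 2.
  rewrite PoszD mulrDl; apply: le_trans (ler_normB _ _) _.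
  apply: lerD; first exact: form_le.
  by rewrite normrM !PoszM -mulrA abszE (normrM 2) -[`|2|]/(2 : int) -!mulrA !ler_wpM2l.
have eH : (C * H ^ 2)%:Z = C%:Z * H%:Z ^+ 2 by rewrite PoszM -mulnn PoszM expr2.
apply: height_frac_le; first by rewrite denE expf_neq0.
  by rewrite eH (le_trans hnum) // ler_wpM2r ?exprn_ge0 // lez_nat leq_addr.
have hden : `|den| <= (form_norm c2)%:Z * H%:Z ^+ 2 by apply: form_le.
by rewrite eH (le_trans hden) // ler_wpM2r ?exprn_ge0 // lez_nat leq_addl.
Qed.
End Translation.

(** * Two-descent *)

Lemma even_logn_sqr (n : nat) : (0 < n)%N ->
  (forall p, prime p -> ~~ odd (logn p n)) -> exists k, n = (k ^ 2)%N.
Proof.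
elim/ltn_ind: n => n IH n0 hn; have [n1|n1] := leqP n 1.
  by exists 1%N; apply/eqP; rewrite eqn_leq n1.
have pr := pdiv_prime n1; set p := pdiv n in pr.
have pn : (p ^ 2 %| n)%N.
  rewrite pfactor_dvdn //; have : (0 < logn p n)%N by rewrite logn_gt0 mem_primes pr n0 pdiv_dvd.
  by have := hn p pr; case: (logn p n) => [|[|]].
have [m mE] := dvdnP pn.
have m0 : (0 < m)%N by move: n0; rewrite mE; case: m {mE}.
have p2 : (0 < p ^ 2)%N by rewrite expn_gt0 prime_gt0.
have [||k kE] := IH m _ m0.
- by rewrite mE ltn_Pmulr // (ltn_sqr 1 p) prime_gt1.
- move=> q qp; have := hn q qp; rewrite mE lognM // lognX oddD.
  by rewrite oddM /= addbF.
by exists (k * p)%N; rewrite mE kE expnMn.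
Qed.

(* For integers whose odd-order primes are at most M this determines the square
   class. *)
Definition sqclass (M : nat) (n : int) : bool * {ffun 'I_M.+1 -> bool} :=
  (n < 0, [ffun p : 'I_M.+1 => odd (logn p `|n|%N)]).

Lemma sqclass_sqr M (n k : int) : n != 0 -> k != 0 ->
  (forall p, prime p -> (M < p)%N -> ~~ odd (logn p `|n|%N)) ->
  (forall p, prime p -> (M < p)%N -> ~~ odd (logn p `|k|%N)) ->
  sqclass M n = sqclass M k -> exists s : int, n * k = s ^+ 2.
Proof.
move=> n0 k0 hn hk [esg /ffunP ev].
have [||s sE] := @even_logn_sqr (`|n| * `|k|)%N.
- by rewrite muln_gt0 !absz_gt0 n0.
- move=> p pr; rewrite lognM ?absz_gt0 // oddD.
  have [pM|pM] := leqP p M; last by rewrite (negPf (hn p pr pM)) (negPf (hk p pr pM)).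
  by have := ev (inord p); rewrite !ffunE inordK // => ->; rewrite addbb.
exists s%:Z; rewrite -abszM in sE.
have nk : 0 <= n * k.
  case: (ltP n 0) esg => hn0; case: (ltP k 0) => hk0 // _.
    by rewrite mulr_le0 // ltW.
  by rewrite mulr_ge0.
by rewrite -[n * k]gez0_abs // sE -mulnn PoszM expr2.
Qed.

(** If [p] divides [z] or [m - e z], it divides no other factor of the product, so its exponent
    there is the exponent in a square. *)
Lemma even_val (p : nat) (m z e f g s : int) : prime p -> coprimez m z -> z != 0 -> s != 0 ->
  ~~ (p%:Z %| e - f)%Z -> ~~ (p%:Z %| e - g)%Z ->
  (m - e * z) * (m - f * z) * (m - g * z) * z = s ^+ 2 ->
  ~~ odd (logn p (absz ((m - e * z) * z))).
Proof.
move=> pr co z0 s0 pf pg sE.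
have := expf_neq0 2 s0; rewrite -sE !mulf_eq0 !negb_or => /andP[/andP[/andP[e0 f0] g0] _].
have /(congr1 (fun t => logn p `|t|%N)) := sE.
rewrite abszX lognX !abszM !lognM ?muln_gt0 ?absz_gt0 ?e0 ?f0 ?g0 // => vE.
have ndv (t : int) : ~~ (p%:Z %| t)%Z -> logn p `|t|%N = 0%N.
  by rewrite dvdzE /= lognE => /negPf ->; rewrite !andbF.
have prM (t u : int) : (p%:Z %| t * u)%Z = (p%:Z %| t)%Z || (p%:Z %| u)%Z.
  by rewrite !dvdzE abszM Euclid_dvdM.
have [pz|pz] := boolP (p%:Z %| z)%Z.
  have pm : ~~ (p%:Z %| m)%Z.
    apply/negP => pm; have : (p%:Z %| gcdz m z)%Z by rewrite dvdz_gcd pm.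
    by rewrite (eqP co) dvdzE /= dvdn1 => /eqP p1; rewrite p1 in pr.
  have nd (t : int) : ~~ (p%:Z %| m - t * z)%Z.
    apply: contra pm => h; have -> : m = (m - t * z) + t * z by ring.
    by rewrite rpredD // dvdz_mull.
  rewrite (ndv _ (nd e)) !(ndv _ (nd _)) !add0n in vE *.
  by rewrite vE oddM.
have [pe|pe] := boolP (p%:Z %| m - e * z)%Z; last by rewrite (ndv _ pe) (ndv _ pz).
have nd (t : int) : ~~ (p%:Z %| e - t)%Z -> ~~ (p%:Z %| m - t * z)%Z.
  move=> h; apply/negP => pt; have : (p%:Z %| (e - t) * z)%Z.
    have -> : (e - t) * z = (m - t * z) - (m - e * z) by ring.
    by rewrite rpredB.
  by rewrite prM (negPf h) (negPf pz).
rewrite (ndv _ pz) (ndv _ (nd _ pf)) (ndv _ (nd _ pg)) !addn0 in vE *.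
by rewrite vE oddM.
Qed.

(** Whether a class is met is not decided but settled by excluded middle, once for each of the
    finitely many classes. *)
Lemma class_representatives (T : Type) (C : finType) (Q : T -> Prop) (cls : T -> C) :
  exists S : seq T, (forall R, List.In R S -> Q R) /\
    forall P, Q P -> exists R, List.In R S /\ cls R = cls P.
Proof.
suff h (s : seq C) : exists S : seq T, (forall R, List.In R S -> Q R) /\
    forall P, Q P -> cls P \in s -> exists R, List.In R S /\ cls R = cls P.
  have [S [h1 h2]] := h (enum C); exists S; split=> // P QP.
  by apply: h2 => //; rewrite mem_enum.
elim: s => [|c s [S [h1 h2]]]; first by exists [::].
have [[P0 [QP0 c0]]|no] := classic (exists P, Q P /\ cls P = c).
  exists (P0 :: S); split=> [R /= [<-|]|P QP]; [by []|exact: h1|].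
  rewrite in_cons => /orP[/eqP e|hs]; first by exists P0; split; [left|rewrite c0].
  by have [R [RS cR]] := h2 P QP hs; exists R; split=> //; right.
exists S; split=> // P QP; rewrite in_cons => /orP[/eqP e|]; last exact: h2.
by case: no; exists P.
Qed.

(** The abscissas on a line are the roots of the cubic minus the square of the line. At a root [t]
    of the cubic the product is a square, which drives the 2-descent; where the cubic is negative it
    is positive over the reals, which separates the real components. *)
Lemma secant_prod a b x1 y1 x2 y2 l t : y1 ^+ 2 = x1 ^+ 3 + ratr a * x1 + ratr b ->
  secant a x1 y1 x2 y2 l ->
  (x1 - t) * (x2 - t) * (l ^+ 2 - x1 - x2 - t) =
  (y1 + l * (t - x1)) ^+ 2 - (t ^+ 3 + ratr a * t + ratr b).
Proof.
move=> h1 [hy ha].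
have -> : ratr b = y1 ^+ 2 - x1 ^+ 3 - ratr a * x1 by rewrite h1; ring.
rewrite ha; have -> : y2 = y1 - l * (x1 - x2) by rewrite hy; ring.
ring.
Qed.

Section RationalPoints.
Variables a b : rat.
Definition on_ratcurve (x y : rat) := y ^+ 2 = x ^+ 3 + a * x + b.
Definition ratpt (x y : rat) : point := Some (ratr x, ratr y).

Lemma ratpt_on x y : on_ratcurve x y <-> on_curve a b (ratpt x y).
Proof.
have -> : on_curve a b (ratpt x y) <-> ratr (y ^+ 2) = ratr (x ^+ 3 + a * x + b) :> algC.
  by rewrite rmorphXn /= 2!rmorphD /= rmorphXn /= rmorphM.
by split=> [->|/fmorph_inj].
Qed.

Lemma ratpt_add x1 y1 x2 y2 : on_ratcurve x1 y1 -> on_ratcurve x2 y2 ->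
  (x1 = x2 /\ y1 = - y2) \/
  exists l, let x3 := l ^+ 2 - x1 - x2 in let y3 := l * (x1 - x3) - y1 in
   [/\ (x1 != x2 -> l = (y2 - y1) / (x2 - x1)),
       ec_add a (ratpt x1 y1) (ratpt x2 y2) = ratpt x3 y3, on_ratcurve x3 y3 &
     forall t, (x1 - t) * (x2 - t) * (x3 - t) = (y1 + l * (t - x1)) ^+ 2 - (t ^+ 3 + a * t + b)].
Proof.
move=> h1 h2; have [o1 o2] := ((ratpt_on x1 y1).1 h1, (ratpt_on x2 y2).1 h2).
have key l : secant a (ratr x1) (ratr y1) (ratr x2) (ratr y2) (ratr l) ->
    let x3 := l ^+ 2 - x1 - x2 in let y3 := l * (x1 - x3) - y1 in
    [/\ third (ratr x1) (ratr y1) (ratr x2) (ratr l) = ratpt x3 y3, on_ratcurve x3 y3 &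
     forall t, (x1 - t) * (x2 - t) * (x3 - t) = (y1 + l * (t - x1)) ^+ 2 - (t ^+ 3 + a * t + b)].
  move=> hs x3 y3.
  have e3 : third (ratr x1) (ratr y1) (ratr x2) (ratr l) = ratpt x3 y3.
    rewrite /third /ratpt /y3 /x3; congr Some; congr pair; ring.
  split=> //; first by apply/ratpt_on; rewrite -e3; apply: third_on hs.
  move=> t; apply: (@fmorph_inj _ _ (@ratr algC)).
  transitivity ((ratr x1 - ratr t) * (ratr x2 - ratr t) *
    (ratr l ^+ 2 - ratr x1 - ratr x2 - ratr t) : algC); first by rewrite /x3; ring.
  by rewrite (secant_prod (ratr t) o1 hs); ring.
have [e12|n12] := eqVneq x1 x2; last first.
  have n12' : ratr x1 != ratr x2 :> algC by rewrite fmorph_eq.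
  have hs := chord_secant o1 o2 n12'.
  right; exists ((y2 - y1) / (x2 - x1)).
  have hl : ratr ((y2 - y1) / (x2 - x1)) = (ratr y2 - ratr y1) / (ratr x2 - ratr x1) :> algC.
    by rewrite fmorph_div !rmorphB.
  rewrite -hl in hs; have [k1 k2 k3] := key _ hs.
  by split=> //; rewrite /ratpt ec_add_chord // -hl.
have [ey|ny] := eqVneq y1 (- y2); first by left.
right; rewrite -{x2}e12 in h2 o2 key *.
have ey : y2 = y1.
  move/eqP: (etrans h1 (esym h2)); rewrite eqf_sqr => /orP[/eqP //|/eqP e].
  by rewrite e eqxx in ny.
rewrite {y2}ey in ny h2 o2 key *.
have y0 : 2 * ratr y1 != 0 :> algC.
  move: ny; rewrite -addr_eq0 -mulr2n -[y1 *+ 2]mulr_natl mulf_eq0 negb_or => /andP[_ ny].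
  by rewrite mulf_neq0 ?two_algC // fmorph_eq0.
have hs := tangent_secant a (ratr x1) y0.
exists ((3 * x1 ^+ 2 + a) / (2 * y1)).
have hl : ratr ((3 * x1 ^+ 2 + a) / (2 * y1)) = (3 * ratr x1 ^+ 2 + ratr a) / (2 * ratr y1) :> algC.
  by rewrite fmorph_div; congr (_ / _); ring.
rewrite -hl in hs; have [k1 k2 k3] := key _ hs.
by split=> //; rewrite ?eqxx // /ratpt ec_add_tangent // -hl.
Qed.

End RationalPoints.

Section FullTorsion.
Variables e1 e2 e3 : int.
Hypotheses (n12 : e1 != e2) (n13 : e1 != e3) (n23 : e2 != e3).
Hypothesis esum : e1 + e2 + e3 = 0.

Definition root_coefA : int := e1 * e2 + e1 * e3 + e2 * e3.
Definition root_coefB : int := - (e1 * e2 * e3).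
Let a : rat := root_coefA%:~R.
Let b : rat := root_coefB%:~R.

Lemma full_disc : 4 * root_coefA ^+ 3 + 27 * root_coefB ^+ 2 =
  - ((e1 - e2) * (e1 - e3) * (e2 - e3)) ^+ 2.
Proof.
rewrite /root_coefA /root_coefB; have -> : e3 = - e1 - e2 by rewrite -[LHS]addr0 -oppr0 -esum; ring.
ring.
Qed.

Lemma full_disc_neq0 : 4 * root_coefA ^+ 3 + 27 * root_coefB ^+ 2 != 0.
Proof. by rewrite full_disc oppr_eq0 expf_neq0 // !mulf_neq0 // subr_eq0. Qed.

Lemma full_nonsingular : nonsingular a b.
Proof.
rewrite /nonsingular /ec_disc.
have -> : 4 * a ^+ 3 + 27 * b ^+ 2 = (4 * root_coefA ^+ 3 + 27 * root_coefB ^+ 2)%:~R.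
  by rewrite /a /b; ring.
by rewrite intr_eq0 full_disc_neq0.
Qed.

Let ns := full_nonsingular.
Notation E := (ecpt ns).

Lemma full_split x : x ^+ 3 + a * x + b = (x - e1%:~R) * (x - e2%:~R) * (x - e3%:~R).
Proof.
rewrite /a /b /root_coefA /root_coefB; have -> : e3 = - e1 - e2 by rewrite -[LHS]addr0 -oppr0 -esum; ring.
ring.
Qed.

(* The half of (X, Y) has abscissa X + s1 s2 + s1 s3 + s2 s3 and tangent slope
   s1 + s2 + s3. *)
Lemma halve (X Y s1 s2 s3 : rat) : on_ratcurve a b X Y ->
  X - e1%:~R = s1 ^+ 2 -> X - e2%:~R = s2 ^+ 2 -> X - e3%:~R = s3 ^+ 2 ->
  exists x y : rat, [/\ on_ratcurve a b x y, y != 0,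
     X = ((3 * x ^+ 2 + a) / (2 * y)) ^+ 2 - 2 * x &
     ec_add a (ratpt x y) (ratpt x y) = ratpt X Y].
Proof.
move=> oXY.
(* [Y] is the product of the three square roots up to sign; the sign is absorbed into [s1]. *)
wlog YE : s1 / Y = s1 * s2 * s3 => [hw|] h1 h2 h3.
  have : Y ^+ 2 = (s1 * s2 * s3) ^+ 2 by rewrite oXY full_split h1 h2 h3; ring.
  move/eqP; rewrite eqf_sqr => /orP[/eqP|/eqP] hY; first exact: (hw s1).
  by apply: (hw (- s1)) => //; rewrite ?sqrrN ?h1 // hY; ring.
pose x := X + s1 * s2 + s1 * s3 + s2 * s3.
pose y := (s1 + s2) * (s1 + s3) * (s2 + s3).
have E1 : e1%:~R = X - s1 ^+ 2 by rewrite -h1; ring.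
have E2 : e2%:~R = X - s2 ^+ 2 by rewrite -h2; ring.
have E3 : e3%:~R = X - s3 ^+ 2 by rewrite -h3; ring.
have XE : X = (s1 ^+ 2 + s2 ^+ 2 + s3 ^+ 2) / 3.
  have : (e1 + e2 + e3)%:~R = 0 :> rat by rewrite esum.
  by rewrite !rmorphD /= E1 E2 E3; lra.
have sum_neq0 (e f : int) (s t : rat) : e != f -> e%:~R = X - s ^+ 2 ->
    f%:~R = X - t ^+ 2 -> s + t != 0.
  move=> nef es ft; apply: contraNneq nef => st.
  by rewrite -(eqr_int rat) es ft; have -> : s = - t by [lra]; rewrite sqrrN.
have s12 := sum_neq0 _ _ _ _ n12 E1 E2.
have s13 := sum_neq0 _ _ _ _ n13 E1 E3.
have s23 := sum_neq0 _ _ _ _ n23 E2 E3.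
have y0 : y != 0 by rewrite !mulf_neq0.
have oxy : on_ratcurve a b x y.
  by rewrite /on_ratcurve full_split E1 E2 E3 /x /y; ring.
have slope : (3 * x ^+ 2 + a) / (2 * y) = s1 + s2 + s3.
  have -> : a = e1%:~R * e2%:~R + e1%:~R * e3%:~R + e2%:~R * e3%:~R by rewrite /a /root_coefA; ring.
  rewrite E1 E2 E3 /x /y XE; field; rewrite ?s12 ?s13 ?s23 //.
exists x, y; split=> //.
  by rewrite slope /x XE; field.
have y0' : 2 * ratr y != 0 :> algC by rewrite mulf_neq0 ?two_algC // fmorph_eq0.
rewrite /ratpt ec_add_tangent // /third.
have -> : (3 * ratr x ^+ 2 + ratr a) / (2 * ratr y) = ratr ((3 * x ^+ 2 + a) / (2 * y)) :> algC.
  by rewrite fmorph_div; congr (_ / _); ring.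
rewrite slope; congr Some.
have xX : (s1 + s2 + s3) ^+ 2 - x - x = X by rewrite /x XE; field.
have yY : (s1 + s2 + s3) * (x - X) - y = Y by rewrite YE /x /y; ring.
by congr pair; rewrite -?xX -?yY -?xX; ring.
Qed.

(** Primes beyond this bound divide no difference of the roots, so square classes need recording
    only up to it. *)
Definition torsion_bound : nat := absz ((e1 - e2) * (e1 - e3) * (e2 - e3)).

Lemma torsion_boundP p e f : prime p -> (torsion_bound < p)%N -> e != f ->
  e \in [:: e1; e2; e3] -> f \in [:: e1; e2; e3] -> ~~ (p%:Z %| e - f)%Z.
Proof.
move=> pr pM nef he hf; apply/negP => pd.
have h : (p%:Z %| (e1 - e2) * (e1 - e3) * (e2 - e3))%Z.
  have sw (t u : int) : (p%:Z %| t - u)%Z -> (p%:Z %| u - t)%Z by rewrite -opprB rpredN.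
  have d12 : (p%:Z %| e1 - e2)%Z -> (p%:Z %| (e1 - e2) * (e1 - e3) * (e2 - e3))%Z.
    by move=> h; exact: (dvdz_mulr _ (dvdz_mulr _ h)).
  have d13 : (p%:Z %| e1 - e3)%Z -> (p%:Z %| (e1 - e2) * (e1 - e3) * (e2 - e3))%Z.
    by move=> h; exact: (dvdz_mulr _ (dvdz_mull _ h)).
  have d23 : (p%:Z %| e2 - e3)%Z -> (p%:Z %| (e1 - e2) * (e1 - e3) * (e2 - e3))%Z.
    by move=> h; exact: (dvdz_mull _ h).
  move: he hf nef pd; rewrite !inE => /or3P[] /eqP-> /or3P[] /eqP->; rewrite ?eqxx // => _;
    by [exact: d12 | exact: d13 | exact: d23 | move/sw; exact: d12 | move/sw; exact: d13
       | move/sw; exact: d23].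
move: h; rewrite dvdzE /= => /dvdn_leq; rewrite absz_gt0 !mulf_neq0 ?subr_eq0 // => /(_ isT).
by rewrite leqNgt pM.
Qed.

(** The 2-descent map: [(m - e z) z] represents [x - e] modulo squares. *)
Definition pt_class (P : rat * rat) :=
  let m := numq P.1 in let z := denq P.1 in let c e := sqclass torsion_bound ((m - e * z) * z) in
  (c e1, c e2, c e3).

Lemma pt_class_eq x y r s : on_ratcurve a b x y -> on_ratcurve a b r s -> y != 0 -> s != 0 ->
  pt_class (x, y) = pt_class (r, s) -> forall e, e \in [:: e1; e2; e3] ->
  exists t : rat, (x - e%:~R) * (r - e%:~R) = t ^+ 2.
Proof.
have base u v : on_ratcurve a b u v -> v != 0 -> exists2 t : int, t != 0 &
  (numq u - e1 * denq u) * (numq u - e2 * denq u) * (numq u - e3 * denq u) * denq u = t ^+ 2.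
  move=> ouv v0; pose m := numq u; pose z := denq u.
  have z0 : z%:~R != 0 :> rat by rewrite intr_eq0 denq_eq0.
  have uE : u = m%:~R / z%:~R by rewrite divq_num_den.
  have e : (v * z%:~R ^+ 2) ^+ 2 =
      ((m - e1 * z) * (m - e2 * z) * (m - e3 * z) * z)%:~R.
    by rewrite exprMn ouv full_split uE; field.
  have [t tE] := sqr_rat_int e; exists t.
    by rewrite -(intr_eq0 rat) -tE mulf_neq0 ?expf_neq0.
  by apply: (@intr_inj rat); rewrite -e tE rmorphXn.
move=> oxy ors y0 s0 hc e he.
have [t t0 tE] := base _ _ oxy y0; have [t' t0' tE'] := base _ _ ors s0.
have ce : sqclass torsion_bound ((numq x - e * denq x) * denq x) =
          sqclass torsion_bound ((numq r - e * denq r) * denq r).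
  move: he; rewrite !inE => /or3P[] /eqP->.
  - exact: (congr1 (fun c => c.1.1) hc).
  - exact: (congr1 (fun c => c.1.2) hc).
  - exact: (congr1 snd hc).
have ev u w : (numq u - e1 * denq u) * (numq u - e2 * denq u) * (numq u - e3 * denq u) * denq u
   = w ^+ 2 -> w != 0 -> forall p, prime p -> (torsion_bound < p)%N ->
   ~~ odd (logn p (absz ((numq u - e * denq u) * denq u))).
  move=> wE w0 p pr pM.
  have co : coprimez (numq u) (denq u) by rewrite coprimezE coprime_num_den.
  have z0 : denq u != 0 by rewrite denq_eq0.
  have ev f g k := @even_val p (numq u) (denq u) f g k w pr co z0 w0.
  have nd f g : f != g -> f \in [:: e1; e2; e3] -> g \in [:: e1; e2; e3] ->
    ~~ (p%:Z %| f - g)%Z by apply: torsion_boundP.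
  move: he; rewrite !inE => /or3P[] /eqP->.
  - by apply: (ev _ e2 e3) => //; apply: nd; rewrite ?inE ?eqxx ?orbT // eq_sym.
  - by apply: (ev _ e1 e3); rewrite -?wE; try ring; apply: nd; rewrite ?inE ?eqxx ?orbT // eq_sym.
  - by apply: (ev _ e1 e2); rewrite -?wE; try ring; apply: nd; rewrite ?inE ?eqxx ?orbT // eq_sym.
have nz u w : (numq u - e1 * denq u) * (numq u - e2 * denq u) * (numq u - e3 * denq u) * denq u
   = w ^+ 2 -> w != 0 -> (numq u - e * denq u) * denq u != 0.
  move=> wE w0; have := expf_neq0 2 w0; rewrite -wE !mulf_eq0 !negb_or => /andP[/andP[/andP[h1 h2] h3] h4].
  by rewrite h4 andbT; move: he; rewrite !inE => /or3P[] /eqP->.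
have [k kE] := sqclass_sqr (nz _ _ tE t0) (nz _ _ tE' t0') (ev _ _ tE t0) (ev _ _ tE' t0') ce.
have z0 : (denq x)%:~R != 0 :> rat by rewrite intr_eq0 denq_eq0.
have z0' : (denq r)%:~R != 0 :> rat by rewrite intr_eq0 denq_eq0.
exists (k%:~R / ((denq x)%:~R * (denq r)%:~R)).
rewrite exprMn -rmorphXn /= -kE -{1}[x]divq_num_den -{1}[r]divq_num_den.
by field; rewrite z0 z0'.
Qed.

Definition ecpt_of x y (h : on_ratcurve a b x y) : E := mkpt ns ((ratpt_on a b x y).1 h).

Lemma small_points (H : nat) : exists S : seq E, forall x y (h : on_ratcurve a b x y),
  (height x <= H)%N -> ecpt_of h \in S.
Proof.
have [X hX] := northcott H.
suff [S hS] : exists S : seq E, forall x y (h : on_ratcurve a b x y), x \in X -> ecpt_of h \in S.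
  by exists S => x y h hx; apply: hS; apply: hX.
elim: {hX} X => [|x0 X [S hS]]; first by exists [::].
have [[y0 h0]|no] := classic (exists y, on_ratcurve a b x0 y); last first.
  exists S => x y h; rewrite inE => /orP[/eqP ex|]; last exact: hS.
  by case: no; exists y; rewrite -ex.
exists [:: ecpt_of h0, - ecpt_of h0 & S] => x y h; rewrite inE => /orP[/eqP ex|xX]; last first.
  by rewrite !inE hS // !orbT.
have : y ^+ 2 == y0 ^+ 2 by move: (h); rewrite ex /on_ratcurve => ->; rewrite h0.
rewrite !inE eqf_sqr => /orP[] /eqP ey; apply/orP; [left|right; apply/orP; left];
  apply/eqP; apply: val_inj => /=.
  by rewrite /ratpt ex ey.
by rewrite /ratpt ex ey rmorphN.
Qed.

Lemma list_bound (T : Type) (S : seq T) (P : T -> nat -> Prop) :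
  (forall t c d, P t c -> (c <= d)%N -> P t d) -> (forall t, List.In t S -> exists c, P t c) ->
  exists c, forall t, List.In t S -> P t c.
Proof.
move=> mono; elim: S => [|t S IH] h; first by exists 0%N.
have [c hc] := h t (or_introl erefl); have [d hd] := IH (fun t ht => h t (or_intror ht)).
exists (maxn c d) => u [<-|uS]; first by apply: mono hc _; exact: leq_maxl.
by apply: mono (hd u uS) _; exact: leq_maxr.
Qed.

Lemma finite_generation : exists S : seq E, forall P : E, coords_in Qfield P -> in_span S P.
Proof.
pose Q (P : rat * rat) := on_ratcurve a b P.1 P.2 /\ P.2 != 0.
have [R [RQ Rrep]] := class_representatives Q pt_class.
have [CT hCT] : exists C : nat, forall r, List.In r R -> forall x y : rat,
    on_ratcurve a b x y -> x != r.1 ->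
    (height (((r.2 - y) / (r.1 - x)) ^+ 2 - x - r.1) <= C * height x ^ 2)%N.
  apply: (@list_bound _ R (fun r C => forall x y : rat, on_ratcurve a b x y -> x != r.1 ->
    (height (((r.2 - y) / (r.1 - x)) ^+ 2 - x - r.1) <= C * height x ^ 2)%N)).
    move=> r c d h cd x y oxy nx; apply: leq_trans (h x y oxy nx) _.
    by rewrite leq_mul2r cd orbT.
  by move=> r /RQ[or _]; apply: height_translate or.
have [HR hHR] := @list_bound _ R (fun r c => height r.1 <= c)%N
  (fun _ _ _ => @leq_trans _ _ _) (fun r _ => ex_intro _ (height r.1) (leqnn _)).
have [CD hCD] := height_dup full_disc_neq0.
(* Above this bound [x] is neither a root of the cubic nor the abscissa of a representative, and its
   height exceeds [CD * CT]. The generators are the points below it, representatives included. *)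
pose H0 := (HR + CD * CT + height e1%:~R + height e2%:~R + height e3%:~R)%N.
have [S hS] := small_points H0.
exists S => -[[[x0 y0]|] oP] cP; last first.
  exists (fun _ => 0); rewrite big1 //.
  exact: val_inj.
case: (cP) => [[x xE] [y yE]]; rewrite {}xE {}yE in oP cP *.
have oxy : on_ratcurve a b x y by apply/ratpt_on; exact/on_curveP.
have -> : EcPt ns oP = ecpt_of oxy by apply: val_inj.
clear oP cP x0 y0; have [n] := ubnP (height x).
elim: n x y oxy => [//|n IH] x y oxy; rewrite ltnS => hx.
have [hsmall|hbig] := leqP (height x) H0; first exact/mem_in_span/hS.
have xe e : e \in [:: e1; e2; e3] -> x != e%:~R.
  move=> he; apply: contraTneq hbig => ->; rewrite -leqNgt /H0.
  by move: he; rewrite !inE => /or3P[] /eqP->; lia.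
have y0 : y != 0.
  have : (x - e1%:~R) * (x - e2%:~R) * (x - e3%:~R) != 0.
    by rewrite !mulf_neq0 // subr_eq0 xe // !inE eqxx ?orbT.
  by rewrite -full_split -oxy sqrf_eq0.
have [[r s] [rR rcls]] := Rrep (x, y) (conj oxy y0).
have [/= ors s0] := RQ _ rR.
have xr : x != r.
  by apply: contraTneq hbig => ->; rewrite -leqNgt; apply: leq_trans (hHR _ rR) _; rewrite /H0 /=; lia.
have [[xr' _]|[l [/(_ xr) lE addE o3 prodE]]] := ratpt_add oxy ors; first by rewrite xr' eqxx in xr.
set x3 := l ^+ 2 - x - r in addE o3 prodE; set y3 := l * (x - x3) - y in addE o3.
have hx3 : (height x3 <= CT * height x ^ 2)%N by rewrite /x3 lE; apply: (hCT _ rR).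
(* Equal classes make [(x - e) (r - e)] a square, and collinearity makes [(x - e) (r - e) (x3 - e)]
   one; so the sum with the representative can be halved. *)
have sq e : e \in [:: e1; e2; e3] -> exists t, x3 - e%:~R = t ^+ 2.
  move=> he; have [t tE] := pt_class_eq ors oxy s0 y0 rcls he.
  have fe : e%:~R ^+ 3 + a * e%:~R + b = 0.
    by rewrite full_split; move: he; rewrite !inE => /or3P[] /eqP->; rewrite subrr ?(mulr0,mul0r).
  have re : r - e%:~R != 0.
    apply: contraNneq s0 => h; rewrite -sqrf_eq0 ors.
    have -> : r = e%:~R by apply/eqP; rewrite -subr_eq0 h.
    by rewrite fe.
  have t0 : t != 0.
    by rewrite -sqrf_eq0 -tE mulf_neq0 // subr_eq0 xe.
  exists ((y + l * (e%:~R - x)) / t).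
  rewrite expr_div_n -tE; apply: (canRL (mulfK _)).
    by rewrite mulf_neq0 // subr_eq0 xe.
  by have := prodE e%:~R; rewrite fe subr0 => <-; ring.
have [s1 h1] : exists t, x3 - e1%:~R = t ^+ 2 by apply: sq; rewrite !inE eqxx.
have [s2 h2] : exists t, x3 - e2%:~R = t ^+ 2 by apply: sq; rewrite !inE eqxx orbT.
have [s3 h3] : exists t, x3 - e3%:~R = t ^+ 2 by apply: sq; rewrite !inE eqxx !orbT.
have [u [v [ouv v0 x3E dblE]]] := halve o3 h1 h2 h3.
(* Otherwise [H(x)^4 <= H(u)^4 <= CD H(x3) <= CD CT H(x)^2], although [H(x) > CD CT]. *)
have hu : (height u < height x)%N.
  rewrite ltnNge; apply/negP => hle.
  have fu : u ^+ 3 + root_coefA%:~R * u + root_coefB%:~R != 0 by rewrite -ouv sqrf_eq0.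
  have := hCD u fu.
  have -> : ((u ^+ 2 - root_coefA%:~R) ^+ 2 - 8 * root_coefB%:~R * u) /
       (4 * (u ^+ 3 + root_coefA%:~R * u + root_coefB%:~R)) = x3.
    rewrite x3E -/a -/b -ouv.
    have -> : b = v ^+ 2 - u ^+ 3 - a * u by rewrite ouv; ring.
    by field.
  move=> hd.
  have hx0 := height_gt0 x.
  have : (height x ^ 4 <= CD * CT * height x ^ 2)%N.
    rewrite -mulnA; apply: leq_trans (leq_mul (leqnn CD) hx3).
    by apply: leq_trans hd; rewrite leq_exp2r.
  rewrite (expnD _ 2 2) leq_pmul2r ?expn_gt0 ?hx0 // => hh.
  have : (height x <= CD * CT)%N by apply: leq_trans hh; rewrite -mulnn leq_pmulr.
  by move: hbig; rewrite /H0; lia.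
have -> : ecpt_of oxy = ecpt_of ouv + ecpt_of ouv - ecpt_of ors.
  apply/eqP; rewrite eq_sym subr_eq; apply/eqP; apply: val_inj.
  exact: etrans dblE (esym addE).
have hu' : (height u < n)%N := leq_trans hu hx.
apply: in_spanD; first by apply: in_spanD; apply: IH.
apply/in_spanN/mem_in_span/hS; apply: leq_trans (hHR _ rR) _; rewrite /H0 /=; lia.
Qed.

End FullTorsion.

(** * Cyclic cubic fields *)

(* If d is a square root of the discriminant of T^3 + p T + q, this permutes the
   three roots cyclically: the numerator quotient is the difference of the two
   roots other than w. *)
Definition cubic_conj (R : fieldType) (p q d w : R) : R :=
  (- w + (- 6 * p * w ^+ 2 + 9 * q * w - 4 * p ^+ 2) / d) / 2.

Section CubicConjugates.
Variables (R : fieldType) (p q d : R).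
Hypotheses (two_neq0 : 2 != 0 :> R) (d_neq0 : d != 0).
Hypothesis dE : d ^+ 2 = - 4 * p ^+ 3 - 27 * q ^+ 2.
Let f w := w ^+ 3 + p * w + q.
Let phi := cubic_conj p q d.

Let u w := (- 6 * p * w ^+ 2 + 9 * q * w - 4 * p ^+ 2) / d.

Let u_sqr w : f w = 0 -> u w ^+ 2 = - 3 * w ^+ 2 - 4 * p.
Proof.
move=> fw; rewrite /u expr_div_n dE; apply: (canLR (mulfK _)).
  by rewrite -dE expf_neq0.
apply/eqP; rewrite -subr_eq0; apply/eqP.
transitivity ((36 * p ^+ 2 * w - 108 * p * q) * f w); first by rewrite /f; ring.
by rewrite fw mulr0.
Qed.

Let u_der w : f w = 0 -> u w * (3 * w ^+ 2 + p) = d.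
Proof.
move=> fw; apply: (mulIf d_neq0); rewrite -expr2 dE /u.
rewrite mulrAC divfK //; apply/eqP; rewrite -subr_eq0; apply/eqP.
transitivity ((- 18 * p * w + 27 * q) * f w); last by rewrite fw mulr0.
by rewrite /f; ring.
Qed.

Let phiE w : 2 * phi w = u w - w.
Proof. by rewrite /phi /cubic_conj -/(u w); field. Qed.

Lemma cubic_conj_root w : f w = 0 -> f (phi w) = 0.
Proof.
move=> fw; have four : 4 != 0 :> R by rewrite (natrM _ 2 2) mulf_neq0.
have h : phi w ^+ 2 + w * phi w + w ^+ 2 + p = 0.
  apply: (mulfI four); rewrite mulr0.
  transitivity ((2 * phi w) ^+ 2 + 2 * w * (2 * phi w) + 4 * w ^+ 2 + 4 * p); first by ring.
  by rewrite phiE; transitivity (u w ^+ 2 + 3 * w ^+ 2 + 4 * p); [ring | rewrite u_sqr //; ring].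
transitivity (f w + (phi w - w) * (phi w ^+ 2 + w * phi w + w ^+ 2 + p)); first by rewrite /f; ring.
by rewrite fw h mulr0 addr0.
Qed.

Lemma cubic_conj_quadratic w : f w = 0 -> phi w ^+ 2 + w * phi w + w ^+ 2 + p = 0.
Proof.
move=> fw; have four : 4 != 0 :> R by rewrite (natrM _ 2 2) mulf_neq0.
apply: (mulfI four); rewrite mulr0.
transitivity ((2 * phi w) ^+ 2 + 2 * w * (2 * phi w) + 4 * w ^+ 2 + 4 * p); first by ring.
by rewrite phiE; transitivity (u w ^+ 2 + 3 * w ^+ 2 + 4 * p); [ring | rewrite u_sqr //; ring].
Qed.

Let der_prod w : f w = 0 -> 3 * w ^+ 2 + p = (w - phi w) * (2 * w + phi w).
Proof.
move=> fw; apply/eqP; rewrite -subr_eq0; apply/eqP.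
by rewrite -(cubic_conj_quadratic fw); ring.
Qed.

(** As the third root is [- w - phi w], the factors are the differences of the roots. The
    orientation is pinned down: the product is [d], not [- d]. *)
Lemma cubic_conj_disc w : f w = 0 ->
  (w - phi w) * (2 * w + phi w) * (2 * phi w + w) = d.
Proof. by move=> fw; rewrite -der_prod // phiE subrK mulrC u_der. Qed.

Lemma cubic_conj2 w : f w = 0 -> phi (phi w) = - w - phi w.
Proof.
move=> fw; have fw' := cubic_conj_root fw; have du := u_der fw'.
have dw := cubic_conj_disc fw.
have der' : 3 * phi w ^+ 2 + p = (phi w - w) * (2 * phi w + w).
  by apply/eqP; rewrite -subr_eq0; apply/eqP; rewrite -(cubic_conj_quadratic fw); ring.
have : d != 0 := d_neq0; rewrite -{1}dw !mulf_eq0 !negb_or => /andP[/andP[h1 h2] h3].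
have uE : u (phi w) = - (2 * w + phi w).
  have h4 : (phi w - w) * (2 * phi w + w) != 0 by rewrite mulf_neq0 // -opprB oppr_eq0.
  by apply: (mulIf h4); rewrite -{1}der' du -dw; ring.
by apply: (mulfI two_neq0); rewrite phiE uE; ring.
Qed.

Lemma cubic_conj3 w : f w = 0 -> phi (phi (phi w)) = w.
Proof.
by move=> fw; rewrite (cubic_conj2 (cubic_conj_root fw)) (cubic_conj2 fw); ring.
Qed.

Lemma cubic_conj_neq w : f w = 0 -> phi w != w.
Proof.
move=> fw; apply: contraNneq d_neq0 => h; rewrite -(cubic_conj_disc fw) h.
by rewrite subrr !mul0r.
Qed.

Lemma cubic_factor w x : f w = 0 -> f x = (x - w) * (x - phi w) * (x - phi (phi w)).
Proof.
move=> fw; rewrite cubic_conj2 //.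
transitivity (f x - f w - (x - w) * 0); first by rewrite fw mulr0 !subr0.
by rewrite -(cubic_conj_quadratic fw) /f; ring.
Qed.

End CubicConjugates.

Lemma cubic_conj_rmorph (R S : fieldType) (s : {rmorphism R -> S}) p q d w :
  s (cubic_conj p q d w) = cubic_conj (s p) (s q) (s d) (s w).
Proof.
rewrite /cubic_conj fmorph_div rmorphD /= fmorph_div.
by congr ((_ + _ / _) / _); ring.
Qed.

(** * Fields generated by roots, and their degrees *)

Definition field_gen (ws : seq algC) : algC -> Prop :=
  fun x => forall F, is_subfield F -> (forall y, y \in ws -> F y) -> F x.

Lemma field_gen_subfield ws : is_subfield (field_gen ws).
Proof.
split.
- by move=> F [].
- by move=> F [].
- by move=> x y hx hy F sF hF; have [_ _ h _ _] := sF; apply: h; [apply: hx|apply: hy].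
- by move=> x y hx hy F sF hF; have [_ _ _ h _] := sF; apply: h; [apply: hx|apply: hy].
- by move=> x hx nx F sF hF; have [_ _ _ _ h] := sF; apply: h => //; apply: hx.
Qed.

Lemma mem_field_gen ws w : w \in ws -> field_gen ws w.
Proof. by move=> h F _; apply. Qed.

Section Subfield.
Variable F : algC -> Prop.
Hypothesis sF : is_subfield F.

Lemma subfield0 : F 0. Proof. by case: sF. Qed.
Lemma subfield1 : F 1. Proof. by case: sF. Qed.
Lemma subfieldB x y : F x -> F y -> F (x - y). Proof. by case: sF => _ _ h _ _; apply: h. Qed.
Lemma subfieldM x y : F x -> F y -> F (x * y). Proof. by case: sF => _ _ _ h _; apply: h. Qed.
Lemma subfieldN x : F x -> F (- x).
Proof. by rewrite -sub0r; apply: subfieldB; apply: subfield0. Qed.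
Lemma subfieldD x y : F x -> F y -> F (x + y).
Proof. by move=> hx hy; rewrite -[y]opprK; apply: subfieldB => //; apply: subfieldN. Qed.
Lemma subfieldV x : F x -> F x^-1.
Proof.
have [->|x0] := eqVneq x 0; first by rewrite invr0.
by case: sF => _ _ _ _ h; move=> hx; apply: h.
Qed.
Lemma subfieldX x n : F x -> F (x ^+ n).
Proof. by move=> hx; elim: n => [|n IH]; rewrite ?expr0 ?exprS; [apply: subfield1|apply: subfieldM]. Qed.
Lemma subfield_nat n : F n%:R.
Proof. by elim: n => [|n IH]; rewrite ?mulrS; [apply: subfield0|apply: subfieldD => //; apply: subfield1]. Qed.
Lemma subfield_int (m : int) : F m%:~R.
Proof. by case: m => n; rewrite ?NegzE ?rmorphN /=; [|apply: subfieldN]; apply: subfield_nat. Qed.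
Lemma subfield_rat (r : rat) : F (ratr r).
Proof. by apply: subfieldM; [|apply: subfieldV]; apply: subfield_int. Qed.
Lemma subfield_cubic_conj p q d w : F p -> F q -> F d -> F w -> F (cubic_conj p q d w).
Proof.
move=> hp hq hd hw; have nat n : F n%:R := subfield_nat n.
apply: subfieldM; last by apply: subfieldV; apply: nat.
apply: subfieldD; first exact: subfieldN.
apply: subfieldM; last exact: subfieldV.
apply: subfieldB; last by apply: subfieldM => //; apply: subfieldX.
apply: subfieldD; last by do 2?apply: subfieldM.
apply: subfieldM; last exact: subfieldX.
by apply: subfieldM => //; apply: subfieldN.
Qed.
End Subfield.

Section NumField.
Variables (Qs : fieldExtType rat) (QsC : {rmorphism Qs -> algC}).

(** Moves questions on subfields of [algC] into a finite extension of [rat], where dimensions and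
    minimal polynomials are available. *)
Lemma field_gen_image (l : seq Qs) x :
  field_gen (map QsC l) x <-> exists2 y, y \in <<1 & l>>%VS & x = QsC y.
Proof.
split.
  move=> h; apply: (h (fun x => exists2 y, y \in <<1 & l>>%VS & x = QsC y)); last first.
    by move=> _ /mapP[y yl ->]; exists y => //; apply: seqv_sub_adjoin.
  split.
  - by exists 0; rewrite ?rpred0 ?rmorph0.
  - by exists 1; rewrite ?rpred1 ?rmorph1.
  - by move=> _ _ [y hy ->] [z hz ->]; exists (y - z); rewrite ?rmorphB // rpredB.
  - by move=> _ _ [y hy ->] [z hz ->]; exists (y * z); rewrite ?rmorphM // rpredM.
  - by move=> _ [y hy ->] _; exists y^-1; rewrite ?fmorphV // rpredV.
case=> y + -> F sF; elim/last_ind: l y => [|l w IH] y.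
  by rewrite Fadjoin_nil => /vlineP[r ->] _; rewrite alg_num_field fmorph_rat; apply: subfield_rat.
rewrite adjoin_rcons => /Fadjoin_polyP[P /polyOverP hP ->] hF.
have hl z : z \in <<1 & l>>%VS -> F (QsC z).
  by move=> hz; apply: IH => // t /mapP[s sl ->]; apply: hF; rewrite map_f // mem_rcons inE sl orbT.
have hw : F (QsC w) by apply: hF; rewrite map_f // mem_rcons inE eqxx.
rewrite horner_coef rmorph_sum /=.
apply: (big_ind F); first exact: subfield0.
  by move=> *; apply: subfieldD.
move=> i _; rewrite rmorphM rmorphXn; apply: subfieldM => //; first exact: hl.
exact: subfieldX.
Qed.

Lemma image_has_degree (U : {vspace Qs}) (K : algC -> Prop) :
  (forall x, K x <-> exists2 y, y \in U & x = QsC y) -> has_degree K (\dim U).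
Proof.
move=> KU; exists (fun i => QsC (vbasis U)`_i); split.
- by move=> i; apply/KU; exists (vbasis U)`_i => //; rewrite vbasis_mem // mem_nth ?size_tuple.
- move=> c c0 i; have := basis_free (vbasisP U) => /freeP; apply.
  apply: (fmorph_inj QsC); rewrite rmorph0 rmorph_sum -[RHS]c0; apply: eq_bigr => j _.
  by rewrite rmorphZ_num.
move=> x /KU[y yU ->]; exists (fun i => coord (vbasis U) i y).
rewrite {1}(coord_vbasis yU) rmorph_sum; apply: eq_bigr => j _.
by rewrite rmorphZ_num.
Qed.

End NumField.

Lemma has_degree_inj K m n : has_degree K m -> has_degree K n -> m = n.
Proof.
suff le r s : has_degree K r -> has_degree K s -> (r <= s)%N.
  by move=> hm hn; apply/eqP; rewrite eqn_leq !le.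
move=> [b [Kb fb _]] [b' [_ _ gb']].
have /fin_all_exists[M hM] : forall i, exists c : 'I_s -> rat, b i = \sum_(j < s) ratr (c j) * b' j.
  by move=> i; apply: gb'.
rewrite leqNgt; apply/negP => lt_sr.
pose A : 'M[rat]_(r, s) := \matrix_(i, j) M i j.
have: kermx A != 0.
  rewrite -mxrank_eq0 mxrank_ker subn_eq0 -ltnNge.
  exact: leq_ltn_trans (rank_leq_col A) lt_sr.
move=> /rowV0Pn[v /sub_kermxP vA]; apply/negP; rewrite negbK; apply/eqP/rowP => i; rewrite mxE.
apply: fb; under eq_bigr do rewrite hM mulr_sumr.
rewrite exchange_big big1 //= => j _.
under eq_bigr do rewrite mulrA -rmorphM; rewrite -mulr_suml -rmorph_sum /=.
have -> : \sum_k v 0 k * M k j = 0; last by rewrite rmorph0 mul0r.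
transitivity ((v *m A) 0 j); last by rewrite vA mxE.
by rewrite mxE; apply: eq_bigr => k _; rewrite mxE.
Qed.

Section CubicExtension.
Variables p q d : int.
Hypotheses (d0 : d != 0) (dE : d ^+ 2 = - 4 * p ^+ 3 - 27 * q ^+ 2).

Definition is_root (R : fieldType) (w : R) := w ^+ 3 + p%:~R * w + q%:~R = 0.
Definition conj3 (R : fieldType) (w : R) : R := cubic_conj p%:~R q%:~R d%:~R w.

Lemma is_root_morph (R S : fieldType) (s : {rmorphism R -> S}) w : is_root (s w) -> is_root w.
Proof. by move=> h; apply: (fmorph_inj s); rewrite rmorph0 -h; ring. Qed.

Lemma conj3_morph (R S : fieldType) (s : {rmorphism R -> S}) w : s (conj3 w) = conj3 (s w).
Proof. by rewrite /conj3 cubic_conj_rmorph !rmorph_int. Qed.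

Section InNumField.
Variables (L : fieldExtType rat) (K : {subfield L}) (v : L).
Hypotheses (rv : is_root v) (Kv : v \notin K) (full : <<K; v>>%VS = fullv).

Let natL n : (n.+1)%:R != 0 :> L.
Proof. by rewrite -(rmorph_nat (in_alg L)) fmorph_eq0 pnatr_eq0. Qed.

Let intL (m : int) : m != 0 -> m%:~R != 0 :> L.
Proof. by move=> m0; rewrite -(rmorph_int (in_alg L)) fmorph_eq0 intr_eq0. Qed.

Let dEL : (d%:~R : L) ^+ 2 = - 4 * p%:~R ^+ 3 - 27 * q%:~R ^+ 2.
Proof. by rewrite -rmorphXn dE; ring. Qed.

Let v1 := conj3 v.
Let v2 := conj3 v1.
Let g : {poly L} := 'X ^+ 3 + (p%:~R)%:P * 'X + (q%:~R)%:P.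
Let mp := minPoly K v.

Let v2E : v2 = - v - v1 := cubic_conj2 (natL 1) (intL d0) dEL rv.

Let gE : g = ('X - v%:P) * ('X - v1%:P) * ('X - v2%:P).
Proof.
have h1 := cubic_conj_quadratic (natL 1) (intL d0) dEL rv.
have pE : p%:~R = - (v1 ^+ 2 + v * v1 + v ^+ 2) :> L.
  by apply/eqP; rewrite -addr_eq0 addrC; apply/eqP.
have qE : q%:~R = - (v ^+ 3 + p%:~R * v) :> L.
  by apply/eqP; rewrite -addr_eq0 addrC; apply/eqP.
rewrite /g v2E qE pE; ring.
Qed.

Let g_over : g \is a polyOver K.
Proof. by rewrite !rpredD ?rpredM ?rpredX ?polyOverX ?polyOverC ?rpred_int. Qed.

Let g_root : root g v.
Proof. by rewrite gE !rootM root_XsubC eqxx. Qed.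

Let mp_dvd : mp %| g. Proof. exact: minPoly_dvdp. Qed.

Lemma adjoin_degree_le3 : (adjoin_degree K v <= 3)%N.
Proof.
have gP : g = \prod_(x <- [:: v; v1; v2]) ('X - x%:P).
  by rewrite gE !big_cons big_nil mulr1 mulrA.
have g0 : g != 0 by rewrite -size_poly_gt0 gP size_prod_XsubC.
by have := dvdp_leq g0 mp_dvd; rewrite size_minPoly gP size_prod_XsubC.
Qed.

(** Otherwise the minimal polynomial, prime to two linear factors of the cubic, would divide the
    third, and [v] would lie in [K]. *)
Lemma minPoly_other_root : root mp v1 \/ root mp v2.
Proof.
have [r1|r1] := boolP (root mp v1); first by left.
have [r2|r2] := boolP (root mp v2); first by right.
have := mp_dvd; rewrite gE Gauss_dvdpl ?coprimep_XsubC // Gauss_dvdpl ?coprimep_XsubC //.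
move/(dvdp_leq (negbT (polyXsubC_eq0 v))); rewrite size_XsubC size_minPoly ltnS => le1.
case/negP: Kv; rewrite -adjoin_deg_eq1 eqn_leq le1; exact: ltn0Sn.
Qed.

Let embed y : root mp y -> exists2 f : {rmorphism L -> L}, (forall x, x \in K -> f x = x) & f v = y.
Proof.
move=> ry; pose f := kHomExtend K \1 v y.
have ry1 : root (map_poly \1%VF mp) y by rewrite lfun1_poly.
have hK : kHom K <<K; v>> f by apply: (kHomExtendP (subvv K) (kHom1 K K) ry1).
have h1 : kHom 1 {:L} f by rewrite -full; apply: kHomSl hK; apply: sub1v.
have /kHom_monoid_morphism fM := h1.
pose fR : {rmorphism L -> L} := HB.pack (fun_of_lfun f) (GRing.isMonoidMorphism.Build _ _ (fun_of_lfun f) fM).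
exists fR => [x xK|]; first by rewrite /= kHomExtend_id // lfunE.
exact: (kHomExtend_val (kHom1 K K) ry1).
Qed.

(** If an embedding sends [v] to [v2], its square sends [v] to [v1], since [conj3] commutes with
    embeddings and has order 3 on the roots. *)
Lemma cubic_embedding : exists2 f : {rmorphism L -> L},
  (forall x, x \in K -> f x = x) & f v = v1.
Proof.
case: minPoly_other_root => /embed[f fK fv]; first by exists f.
exists (f \o f) => [x xK|] /=; first by rewrite !fK.
rewrite fv /v2 /v1 !conj3_morph fv -/v1 /v2.
have h := cubic_conj3 (natL 1) (intL d0) dEL rv.
by rewrite -[conj3 (conj3 (conj3 v))]/(conj3 (conj3 (conj3 v))) [conj3 (conj3 (conj3 v))]h.
Qed.

(** The embedding fixes the coefficients of the minimal polynomial and carries [v] through all three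
    roots, which are distinct. *)
Lemma adjoin_degree3 : adjoin_degree K v = 3%N.
Proof.
apply/eqP; rewrite eqn_leq adjoin_degree_le3 -ltnS -size_minPoly.
have [f fK fv] := cubic_embedding.
have fr x : root mp x -> root mp (f x).
  move=> rx; have <- : map_poly f mp = mp.
    by apply/polyP => i; rewrite coef_map; apply: fK; apply/polyOverP/minPolyOver.
  by rewrite fmorph_root.
have r0 : root mp v := root_minPoly K v.
have r1 : root mp v1 by rewrite -fv fr.
have r2 : root mp v2 by rewrite /v2 -fv -conj3_morph fr // fv.
have rv1 : is_root v1 by apply: (cubic_conj_root (natL 1) (intL d0) dEL rv).
have n01 : v1 != v := cubic_conj_neq (natL 1) (intL d0) dEL rv.
have n12 : v2 != v1 := cubic_conj_neq (natL 1) (intL d0) dEL rv1.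
have n02 : v2 != v.
  apply: contraNneq n01 => h.
  by have := cubic_conj3 (natL 1) (intL d0) dEL rv; rewrite -/(conj3 _) -/v1 -/(conj3 _) -/v2 h => /eqP.
have := @max_poly_roots _ mp [:: v; v1; v2].
rewrite (monic_neq0 (monic_minPoly K v)) /= r0 r1 r2; apply=> //.
by rewrite !inE negb_or eq_sym n01 eq_sym n02 eq_sym n12.
Qed.

End InNumField.

Lemma minpoly_setup ws w : ~ field_gen ws w -> exists (L : fieldExtType rat) (LC : {rmorphism L -> algC})
   (l : seq L) (v : L), [/\ ws = map LC l, w = LC v, v \notin <<1 & l>>%VS
     & <<<<1 & l>>; v>>%VS = fullv].
Proof.
move=> hw; have [L [LC [s sE sF]]] := num_field_exists (rcons ws w).
case/lastP: s sE sF => [|l v]; first by case: ws {hw}.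
rewrite map_rcons => /rcons_inj[lE vE]; rewrite adjoin_rcons => sF.
exists L, LC, l, v; split=> //; apply/negP => hv; apply: hw.
by rewrite -lE -vE; apply/field_gen_image; exists v.
Qed.

Lemma field_gen_aut ws w : is_root w -> ~ field_gen ws w ->
  exists t : {rmorphism algC -> algC}, (forall x, field_gen ws x -> t x = x) /\ t w = conj3 w.
Proof.
move=> rw /minpoly_setup[L [LC [l [v [-> wE vK full]]]]].
have rv : is_root v by apply: (@is_root_morph _ _ LC); rewrite -wE.
have [f fK fv] := cubic_embedding rv vK full.
have [t tf] := extend_algC_subfield_aut LC f.
exists t; split.
  by move=> _ /field_gen_image[y yK ->]; rewrite -tf fK.
by rewrite wE -tf fv conj3_morph.
Qed.

Lemma field_gen_degree ws w n : is_root w -> ~ field_gen ws w ->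
  has_degree (field_gen ws) n -> has_degree (field_gen (rcons ws w)) (3 * n)%N.
Proof.
move=> rw /minpoly_setup[L [LC [l [v [-> wE vK full]]]]].
have rv : is_root v by apply: (@is_root_morph _ _ LC); rewrite -wE.
have h1 := image_has_degree (field_gen_image LC l).
move=> /(has_degree_inj h1) <-.
rewrite wE -map_rcons -(adjoin_degree3 rv vK full) -dim_Fadjoin -adjoin_rcons.
exact: image_has_degree (field_gen_image LC _).
Qed.

Lemma field_gen_decomp ws w x : is_root w -> ~ field_gen ws w -> field_gen (rcons ws w) x ->
  exists b0 b1 b2, [/\ field_gen ws b0, field_gen ws b1, field_gen ws b2
    & x = b0 + b1 * w + b2 * w ^+ 2].
Proof.
move=> rw /minpoly_setup[L [LC [l [v [-> wE vK full]]]]].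
have rv : is_root v by apply: (@is_root_morph _ _ LC); rewrite -wE.
rewrite wE -map_rcons => /field_gen_image[y]; rewrite adjoin_rcons => yK ->.
set P := Fadjoin_poly <<1 & l>>%AS v y.
have hP i : field_gen (map LC l) (LC P`_i).
  by apply/field_gen_image; exists P`_i => //; apply/polyOverP/Fadjoin_polyOver.
exists (LC P`_0), (LC P`_1), (LC P`_2); split=> //.
have sP : (size P <= 3)%N.
  by rewrite -(adjoin_degree3 rv vK full) size_Fadjoin_poly.
rewrite -(Fadjoin_poly_eq yK) -/P (horner_coef_wide _ sP) !big_ord_recl big_ord0 /=.
by ring.
Qed.

End CubicExtension.

Lemma field_gen_nil x : field_gen [::] x -> Qfield x.
Proof.
apply=> //; split.
- by exists 0; rewrite rmorph0.
- by exists 1; rewrite rmorph1.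
- by move=> _ _ [r ->] [s ->]; exists (r - s); rewrite rmorphB.
- by move=> _ _ [r ->] [s ->]; exists (r * s); rewrite rmorphM.
- by move=> _ [r ->] _; exists r^-1; rewrite fmorphV.
Qed.

Lemma is_root_Aint p q (w : algC) : is_root p q w -> w \in Aint.
Proof.
move=> rw; apply: (@root_monic_Aint ('X^3 + (p%:~R)%:P * 'X + (q%:~R)%:P)).
- by rewrite /root !hornerE; apply/eqP.
- have s2 : (size ((p%:~R)%:P * 'X + (q%:~R)%:P : {poly algC})%R <= 2)%N.
    by rewrite size_MXaddC; case: ifP => // _; rewrite ltnS size_polyC leq_b1.
  by rewrite -addrA monicE lead_coefDl ?lead_coefXn // size_polyXn ltnS ltnW.
apply/polyOverP => i; rewrite !coefD coefXn coefCM coefX coefC.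
by rewrite !rpredD ?rpredM ?rpred_nat ?rpred_int //; case: ifP => _; rewrite ?rpred_int ?rpred0.
Qed.

(** * Ramification *)

Section Radical.
Variable P : nat.
Hypothesis prP : prime P.

(* Nilpotents modulo P of the ring of algebraic integers. *)
Definition in_rad (x : algC) := x \in Aint /\ exists e, x ^+ e / P%:R \in Aint.

Lemma in_radM x c : c \in Aint -> in_rad x -> in_rad (c * x).
Proof.
move=> hc [hx [e he]]; split; first exact: rpredM.
by exists e; rewrite exprMn -mulrA rpredM // rpredX.
Qed.

Lemma in_radD x y : in_rad x -> in_rad y -> in_rad (x + y).
Proof.
move=> [hx [e he]] [hy [f hf]]; split; first exact: rpredD.
exists (e + f)%N; rewrite exprDn mulr_suml; apply: rpred_sum => i _.
rewrite mulrnAl rpredMn //; have [fi|/ltnW ie] := leqP f i.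
  have -> : x ^+ (e + f - i) * y ^+ i / P%:R = x ^+ (e + f - i) * y ^+ (i - f) * (y ^+ f / P%:R).
    by rewrite -{2}(subnK fi) exprD !mulrA.
  by apply: rpredM => //; apply: rpredM; apply: rpredX.
have -> : x ^+ (e + f - i) * y ^+ i / P%:R = x ^+ (f - i) * y ^+ i * (x ^+ e / P%:R).
  by rewrite -addnBA // exprD; ring.
by apply: rpredM => //; apply: rpredM; apply: rpredX.
Qed.

Lemma in_rad_aut (s : {rmorphism algC -> algC}) x : in_rad x -> in_rad (s x).
Proof.
move=> [hx [e he]]; split; first by rewrite Aint_aut.
by exists e; rewrite -rmorphXn -(rmorph_nat s) -fmorph_div Aint_aut.
Qed.

Let P0 : P%:R != 0 :> algC. Proof. by rewrite pnatr_eq0 -lt0n prime_gt0. Qed.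

Lemma in_rad_rat (r : rat) : in_rad (ratr r) -> ratr r / P%:R \in Aint.
Proof.
move=> [hr [e]]; have rI : ratr r \in (Num.int : {pred algC}).
  by apply: Cint_rat_Aint => //; apply: Crat_rat.
have [m ->] := intrP rI.
move=> he; have kI : (m%:~R ^+ e / P%:R : algC) \in Num.int.
  apply: Cint_rat_Aint => //.
  by rewrite rpredM ?rpredV ?rpredX // ?rpred_int ?rpred_nat.
have [k kE] := intrP kI.
have : (P %| absz m)%N.
  have : (P%:Z %| m ^+ e)%Z.
    apply/dvdzP; exists k; apply: (@intr_inj algC); rewrite rmorphM rmorphXn /= -kE divfK //.
  by rewrite dvdzE abszX /= Euclid_dvdX // => /andP[].
rewrite -[P]/(absz P%:Z) -dvdzE => /dvdzP[c ->].
by rewrite rmorphM /= mulfK // Aint_int.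
Qed.

(* If P divides none of the discriminants, the integers generated by the roots are
   reduced modulo P: writing x = b0 + b1 w + b2 w^2, the conjugates of x under an
   automorphism moving only w express d b_i through a Vandermonde system, so each
   d b_i inherits nilpotency and the induction applies to it. *)
Lemma unramified (ws : seq algC) :
  (forall w, w \in ws -> exists p q d : int, [/\ d != 0, d ^+ 2 = - 4 * p ^+ 3 - 27 * q ^+ 2,
      is_root p q w & ~~ (P%:Z %| d)%Z]) ->
  forall x, field_gen ws x -> in_rad x -> x / P%:R \in Aint.
Proof.
elim/last_ind: ws => [|ws w IH] hws x.
  by move=> /field_gen_nil[r ->]; apply: in_rad_rat.
have {}IH : forall x, field_gen ws x -> in_rad x -> x / P%:R \in Aint.
  by apply: IH => v hv; apply: hws; rewrite mem_rcons inE hv orbT.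
have [p [q [d [d0 dE rw Pd]]]] := hws w (etrans (mem_rcons ws w w) (mem_head w ws)).
(* A root already present adds nothing; any other has degree 3 over the field, so that [1, w, w^2]
   span. *)
have [hw|hw] := classic (field_gen ws w).
  move=> hx; apply: IH; apply: (hx _ (field_gen_subfield ws)) => y.
  by rewrite mem_rcons inE => /orP[/eqP ->|/mem_field_gen].
move=> hx; have [b0 [b1 [b2 [h0 h1 h2 xE]]]] := field_gen_decomp d0 dE rw hw hx.
have [t [tK tw]] := field_gen_aut d0 dE rw hw.
have sK := field_gen_subfield ws.
have two0 : 2 != 0 :> algC by rewrite pnatr_eq0.
have d0' : d%:~R != 0 :> algC by rewrite intr_eq0.
have dE' : (d%:~R : algC) ^+ 2 = - 4 * p%:~R ^+ 3 - 27 * q%:~R ^+ 2 by rewrite -rmorphXn dE; ring.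
have wA := is_root_Aint rw.
pose w1 := t w; pose w2 := t w1.
have w1E : w1 = conj3 p q d w := tw.
have w2E : w2 = - w - w1.
  by rewrite /w2 w1E conj3_morph tw; apply: (cubic_conj2 two0 d0' dE' rw).
have disc : (w - w1) * (w - w2) * (w1 - w2) = d%:~R.
  rewrite w2E w1E -[RHS](cubic_conj_disc two0 d0' dE' rw) -/(conj3 p q d w); ring.
have w1A : w1 \in Aint by rewrite Aint_aut.
have w2A : w2 \in Aint by rewrite Aint_aut.
move=> rx; have rx1 := in_rad_aut t rx; have rx2 := in_rad_aut t rx1.
have x1E : t x = b0 + b1 * w1 + b2 * w1 ^+ 2.
  rewrite xE; transitivity (t b0 + t b1 * t w + t b2 * t w ^+ 2); first by ring.
  by rewrite (tK _ h0) (tK _ h1) (tK _ h2).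
have x2E : t (t x) = b0 + b1 * w2 + b2 * w2 ^+ 2.
  rewrite x1E; transitivity (t b0 + t b1 * t w1 + t b2 * t w1 ^+ 2); first by ring.
  by rewrite (tK _ h0) (tK _ h1) (tK _ h2).
have key b c0 c1 c2 : field_gen ws b -> c0 \in Aint -> c1 \in Aint -> c2 \in Aint ->
    d%:~R * b = c0 * x + c1 * t x + c2 * t (t x) -> d%:~R * b / P%:R \in Aint.
  move=> hb hc0 hc1 hc2 e; apply: IH; first by apply: (subfieldM sK) => //; apply: subfield_int.
  by rewrite e; apply: in_radD; [apply: in_radD|]; apply: in_radM.
have k2 : d%:~R * b2 / P%:R \in Aint.
  apply: (@key _ (w1 - w2) (- (w - w2)) (w - w1)) => //; rewrite ?rpredN ?rpredB //.
  by rewrite x2E x1E xE -disc; ring.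
have k1 : d%:~R * b1 / P%:R \in Aint.
  apply: (@key _ (- (w1 - w2) * (w1 + w2)) ((w - w2) * (w + w2)) (- (w - w1) * (w + w1))) => //;
    rewrite ?rpredM ?rpredN ?rpredB ?rpredD //.
  by rewrite x2E x1E xE -disc; ring.
have k0 : d%:~R * b0 / P%:R \in Aint.
  apply: (@key _ (w1 * w2 * (w1 - w2)) (- (w * w2 * (w - w2))) (w * w1 * (w - w1))) => //;
    rewrite ?rpredN ?rpredM ?rpredB //.
  by rewrite x2E x1E xE -disc; ring.
have kx : d%:~R * x / P%:R \in Aint.
  have -> : d%:~R * x / P%:R = d%:~R * b0 / P%:R + d%:~R * b1 / P%:R * w + d%:~R * b2 / P%:R * w ^+ 2.
    by rewrite xE; ring.
  by apply: rpredD; [apply: rpredD => //; apply: rpredM | apply: rpredM => //; apply: rpredX].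
(* [d] is invertible modulo [P], so it can be removed from [d x / P]. *)
have /coprimezP[[u v] /= uv] : coprimez d P.
  by rewrite coprimez_sym coprimezE /= prime_coprime // -[P]/(absz P%:Z) -dvdzE.
have -> : x / P%:R = u%:~R * (d%:~R * x / P%:R) + v%:~R * x.
  transitivity ((u * d + v * P%:Z)%:~R * (x / P%:R)); first by rewrite uv mul1r.
  by rewrite rmorphD !rmorphM /=; field.
by apply: rpredD; apply: rpredM; rewrite ?Aint_int //; case: rx.
Qed.
End Radical.

Section OneCubic.
Variables (p q d : int) (w : algC).
Hypotheses (d0 : d != 0) (dE : d ^+ 2 = - 4 * p ^+ 3 - 27 * q ^+ 2) (rw : is_root p q w).

Let two0 : 2 != 0 :> algC. Proof. by rewrite pnatr_eq0. Qed.
Let d0C : d%:~R != 0 :> algC. Proof. by rewrite intr_eq0. Qed.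
Let dEC : (d%:~R : algC) ^+ 2 = - 4 * p%:~R ^+ 3 - 27 * q%:~R ^+ 2.
Proof. by rewrite -rmorphXn dE; ring. Qed.
Notation phi := (conj3 p q d).

Lemma conj3_root v : is_root p q v -> is_root p q (phi v : algC).
Proof. exact: (cubic_conj_root two0 d0C dEC). Qed.

Lemma conj3_2 v : is_root p q v -> phi (phi v) = - v - phi v :> algC.
Proof. exact: (cubic_conj2 two0 d0C dEC). Qed.

Lemma conj3_3 v : is_root p q v -> phi (phi (phi v)) = v :> algC.
Proof. exact: (cubic_conj3 two0 d0C dEC). Qed.

Lemma conj3_neq v : is_root p q v -> phi v != v :> algC.
Proof. exact: (cubic_conj_neq two0 d0C dEC). Qed.

Lemma conj3_quadratic v : is_root p q v ->
  phi v ^+ 2 + v * phi v + v ^+ 2 + p%:~R = 0 :> algC.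
Proof. exact: (cubic_conj_quadratic two0 d0C dEC). Qed.

Lemma conj3_prod v : is_root p q v -> v * phi v * phi (phi v) = - q%:~R :> algC.
Proof.
move=> rv; have := cubic_factor two0 d0C dEC 0 rv.
rewrite expr0n mulr0 !add0r -!/(conj3 p q d _) => ->; ring.
Qed.

Lemma conj3_roots v x : is_root p q v -> is_root p q (x : algC) ->
  [\/ x = v, x = phi v | x = phi (phi v)].
Proof.
move=> rv rx; have := cubic_factor two0 d0C dEC x rv.
rewrite -!/(conj3 p q d _) [LHS]rx => /esym/eqP; rewrite !mulf_eq0 !subr_eq0.
by case/orP=> [/orP[]|] /eqP ->; [constructor 1|constructor 2|constructor 3].
Qed.

Lemma conj3_field F v : is_subfield F -> F v -> F (phi v).
Proof. by move=> sF Fv; apply: subfield_cubic_conj => //; apply: subfield_int. Qed.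

(* T^3 + p T + q is Eisenstein at P, so w is nilpotent modulo P without being
   divisible by P. *)
Lemma ramified_not_in ws (P : nat) : prime P ->
  (P%:Z %| p)%Z -> (P%:Z %| q)%Z -> ~~ (P%:Z ^+ 2 %| q)%Z ->
  (forall w', w' \in ws -> exists p q d : int, [/\ d != 0, d ^+ 2 = - 4 * p ^+ 3 - 27 * q ^+ 2,
      is_root p q w' & ~~ (P%:Z %| d)%Z]) ->
  ~ field_gen ws w.
Proof.
move=> prP /dvdzP[p' pE] /dvdzP[q' qE] Pq2 hws hw.
have P0 : P%:R != 0 :> algC by rewrite pnatr_eq0 -lt0n prime_gt0.
(* [P] divides [v^3 = - (p v + q)], so the exponent 3 witnesses nilpotency. *)
have div v : is_root p q v -> field_gen ws v -> v / P%:R \in Aint.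
  move=> rv hv; apply: (unramified prP hws hv); split; first exact: is_root_Aint rv.
  exists 3%N; have -> : v ^+ 3 / P%:R = - (p'%:~R * v + q'%:~R).
    have -> : v ^+ 3 = - (p%:~R * v + q%:~R) by apply/eqP; rewrite -addr_eq0 addrA; apply/eqP.
    by rewrite pE qE; field.
  by rewrite rpredN rpredD ?rpredM ?Aint_int // (is_root_Aint rv).
have sF := field_gen_subfield ws.
have h1 := conj3_field sF hw; have h2 := conj3_field sF h1.
have r1 := conj3_root rw; have r2 := conj3_root r1.
(* The field contains all three roots, whose product is [- q]; one factor [P] from each contradicts
   the condition on [P^2]. *)
have : (- q%:~R / P%:R ^+ 3 : algC) \in Aint.
  rewrite -(conj3_prod rw).
  have -> : w * phi w * phi (phi w) / P%:R ^+ 3 = (w / P%:R) * (phi w / P%:R) * (phi (phi w) / P%:R).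
    by field.
  by apply: rpredM; [apply: rpredM|]; apply: div.
move=> hA; have hI : (- q%:~R / P%:R ^+ 3 : algC) \in Num.int.
  by apply: Cint_rat_Aint => //; rewrite rpredM ?rpredN ?rpredV ?rpredX ?rpred_int ?rpred_nat.
have [k kE] := intrP hI.
case/negP: Pq2; apply/dvdzP; exists (- k * P%:Z); apply: (@intr_inj algC).
have -> : q%:~R = - (k%:~R * P%:R ^+ 3) :> algC.
  by rewrite -kE divfK ?expf_neq0 // opprK.
ring.
Qed.

Lemma has_degree_Q : has_degree (field_gen [::]) 1.
Proof.
exists (fun=> 1); split.
- by move=> _; apply: (subfield1 (field_gen_subfield _)).
- by move=> c; rewrite big_ord1 mulr1 => /eqP; rewrite fmorph_eq0 => /eqP h i; rewrite ord1.
by move=> x /field_gen_nil[r ->]; exists (fun=> r); rewrite big_ord1 mulr1.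
Qed.

(** The generator realizes [conj3] on [w]. Any automorphism sends [w] to a root, which is an iterate
    of [conj3] at [w], and agreement on [w] spreads to the field it generates. *)
Lemma cyclic_cubic_field_gen : ~ Qfield w -> cyclic_cubic (field_gen [:: w]).
Proof.
move=> wQ; have w0 : ~ field_gen [::] w by move/field_gen_nil.
have sF := field_gen_subfield [:: w].
have hw : field_gen [:: w] w by apply: mem_field_gen; rewrite inE.
have root_aut (t : {rmorphism algC -> algC}) : is_root p q (t w).
  rewrite /is_root -[RHS](rmorph0 t) -[in RHS]rw; ring.
have h1 := conj3_field sF hw; have h2 := conj3_field sF h1.
split=> //.
- exact: (field_gen_degree d0 dE rw w0 has_degree_Q).
- move=> t x hx; apply: (hx (fun x => field_gen [:: w] (t x))); last first.
    move=> y; rewrite inE => /eqP ->.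
    by case: (conj3_roots rw (root_aut t)) => ->.
  split; rewrite ?rmorph0 ?rmorph1; [exact: (subfield0 sF)|exact: (subfield1 sF)| | |].
  + by move=> y z hy hz; rewrite rmorphB; apply: (subfieldB sF).
  + by move=> y z hy hz; rewrite rmorphM; apply: (subfieldM sF).
  + by move=> y hy _; rewrite fmorphV; apply: (subfieldV sF).
have [t [_ tw]] := field_gen_aut d0 dE rw w0.
exists t => s; have [k kw] : exists k, s w = iter k t w.
  case: (conj3_roots rw (root_aut s)) => ->; [exists 0%N|exists 1%N|exists 2%N] => //=.
  by rewrite tw conj3_morph tw.
have iterB k0 x y : iter k0 t (x - y) = iter k0 t x - iter k0 t y.
  by elim: k0 => //= k0 ->; rewrite rmorphB.
have iterM k0 x y : iter k0 t (x * y) = iter k0 t x * iter k0 t y.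
  by elim: k0 => //= k0 ->; rewrite rmorphM.
have iterV k0 x : iter k0 t x^-1 = (iter k0 t x)^-1.
  by elim: k0 => //= k0 ->; rewrite fmorphV.
exists k => x hx; apply: (hx (fun x => s x = iter k t x)); last by move=> y; rewrite inE => /eqP ->.
split.
- by rewrite rmorph0; elim: (k) => //= k0 <-; rewrite rmorph0.
- by rewrite rmorph1; elim: (k) => //= k0 <-; rewrite rmorph1.
- by move=> y z hy hz; rewrite rmorphB iterB hy hz.
- by move=> y z hy hz; rewrite rmorphM iterM hy hz.
- by move=> y hy _; rewrite fmorphV iterV hy.
Qed.

End OneCubic.

(** * Linear disjointness of the cubic fields *)

Lemma has_degree_ext K K' n : (forall x, K x <-> K' x) -> has_degree K n -> has_degree K' n.
Proof.
move=> KK [b [h1 h2 h3]]; exists b; split=> // [i|x /KK]; [exact/KK|exact: h3].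
Qed.

Lemma field_gen_sub ws ws' x : {subset ws <= ws'} -> field_gen ws x -> field_gen ws' x.
Proof.
by move=> h hx; apply: (hx _ (field_gen_subfield ws')) => y /h; apply: mem_field_gen.
Qed.

Lemma compositum_field_gen (w : nat -> algC) s x :
  compositum (fun m => field_gen [:: w m]) s x <-> field_gen (map w s) x.
Proof.
split=> [h|h F sF hF].
  apply: h; first exact: field_gen_subfield.
  by move=> i y hi; apply: field_gen_sub => z; rewrite inE => /eqP ->; apply: map_f.
apply: h => // _ /mapP[i hi ->]; apply: (hF i) => //; apply: mem_field_gen; exact: mem_head.
Qed.

(** The prime attached to [m] is controlled only at smaller indices, so the roots are adjoined in
    increasing order of index, whence the sorting of [s]. *)
Lemma linearly_disjoint_cubics (p q d : nat -> int) (w : nat -> algC) :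
  (forall m, d m != 0) -> (forall m, d m ^+ 2 = - 4 * p m ^+ 3 - 27 * q m ^+ 2) ->
  (forall m, is_root (p m) (q m) (w m)) ->
  (forall m, exists P : nat, [/\ prime P, (P%:Z %| p m)%Z, (P%:Z %| q m)%Z,
     ~~ (P%:Z ^+ 2 %| q m)%Z & forall i, (i < m)%N -> ~~ (P%:Z %| d i)%Z]) ->
  let K m := field_gen [:: w m] in
  (forall m, cyclic_cubic (K m)) /\ linearly_disjoint K.
Proof.
move=> d0 dE rw hP K.
have notin s m : (forall i, i \in s -> (i < m)%N) -> ~ field_gen (map w s) (w m).
  move=> hs; have [P [prP Pp Pq Pq2 Pd]] := hP m.
  apply: (ramified_not_in (d0 m) (dE m) (rw m) prP Pp Pq Pq2) => _ /mapP[i /hs im ->].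
  by exists (p i), (q i), (d i); split=> //; apply: Pd.
have cyc m : cyclic_cubic (K m).
  apply: (cyclic_cubic_field_gen (d0 m) (dE m) (rw m)) => -[r rE].
  by apply: (notin [::] m) => //; rewrite rE => F sF _; apply: subfield_rat.
split=> // s us deg hdeg.
have deg3 i : i \in s -> deg i = 3%N.
  by move=> /hdeg h; have [_ h3 _ _] := cyc i; apply: has_degree_inj h h3.
pose s' := sort leq s.
have ss' : perm_eq s' s by rewrite perm_sort.
have -> : (\prod_(i <- s) deg i = 3 ^ size s')%N.
  rewrite -(perm_big _ ss') /= (perm_size ss') big_seq.
  rewrite (eq_bigr (fun=> 3%N)); last by move=> i; rewrite (perm_mem ss') => /deg3.
  by rewrite -big_seq big_const_seq count_predT iter_muln_1 (perm_size ss').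
apply: (@has_degree_ext (field_gen (map w s'))).
  move=> x; rewrite compositum_field_gen; split; apply: field_gen_sub => y /mapP[i hi ->];
    by rewrite map_f // -?(perm_mem ss') // (perm_mem ss').
have : sorted ltn s'.
  by rewrite ltn_sorted_uniq_leq sort_uniq us; apply: sort_sorted leq_total _.
elim/last_ind: s' {ss'} => [|l m IH] so; first exact: has_degree_Q.
move: so; rewrite (sorted_pairwise ltn_trans) pairwise_rcons => /andP[/allP lm].
rewrite -(sorted_pairwise ltn_trans) => so'.
rewrite map_rcons size_rcons expnS.
apply: (field_gen_degree (d0 m) (dE m) (rw m)); [exact: notin|exact: IH].
Qed.

(** Applied to the real numbers: the sign argument needs a real slope, so that the square in
    [secant_prod] is nonnegative. *)
Lemma ec_add_field a b K x1 y1 x2 y2 : is_subfield K -> K x1 -> K y1 -> K x2 -> K y2 ->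
  on_curve a b (Some (x1, y1)) -> on_curve a b (Some (x2, y2)) ->
  [/\ x1 = x2, y1 = - y2 & ec_add a (Some (x1, y1)) (Some (x2, y2)) = None] \/
  exists l, [/\ K l, secant a x1 y1 x2 y2 l
    & ec_add a (Some (x1, y1)) (Some (x2, y2)) = third x1 y1 x2 l].
Proof.
move=> sK Kx1 Ky1 Kx2 Ky2 o1 o2.
have [e12|n12] := eqVneq x1 x2; last first.
  right; exists ((y2 - y1) / (x2 - x1)); split; last exact: ec_add_chord.
    by apply: (subfieldM sK); [|apply: (subfieldV sK)]; apply: (subfieldB sK).
  exact: chord_secant o1 o2 n12.
rewrite -{x2 Kx2}e12 in o2 *.
have [ey|ny] := eqVneq y1 (- y2); first by left; split=> //; rewrite /= ey !eqxx.
have ey : y2 = y1.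
  by case: (same_x o1 o2) => // h; rewrite h eqxx in ny.
rewrite {y2 Ky2 o2}ey in ny *.
have y0 : 2 * y1 != 0 by move: ny; rewrite -addr_eq0 -mulr2n -[y1 *+ 2]mulr_natl.
right; exists ((3 * x1 ^+ 2 + ratr a) / (2 * y1)); split.
- have nat n : K n%:R := subfield_nat sK n.
  apply: (subfieldM sK); last by apply: (subfieldV sK); apply: (subfieldM sK).
  apply: (subfieldD sK); last exact: subfield_rat.
  by apply: (subfieldM sK) => //; apply: subfieldX.
- exact: tangent_secant.
exact: ec_add_tangent.
Qed.

Lemma Creal_subfield : is_subfield (fun x => x \is Num.real).
Proof.
split=> //.
- by move=> x y hx hy; rewrite rpredB.
- by move=> x y hx hy; rewrite rpredM.
- by move=> x hx _; rewrite rpredV.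
Qed.

(** * Points of infinite order *)

(* A value t at which the cubic is negative separates the compact real component
   (the egg, left of t) from the identity component. *)
Section RealComponents.
Variables a b t : rat.
Hypothesis gap : t ^+ 3 + a * t + b < 0.

Definition real_coords := coords_in (fun x => x \is Num.real).
Definition on_egg (P : point) := if P is Some (x, _) then x < ratr t else false.
Definition on_identity_component (P : point) := if P is Some (x, _) then ratr t < x else true.

Lemma third_sign x1 y1 x2 y2 l : on_curve a b (Some (x1, y1)) -> secant a x1 y1 x2 y2 l ->
  x1 \is Num.real -> y1 \is Num.real -> l \is Num.real ->
  0 < (x1 - ratr t) * (x2 - ratr t) * (l ^+ 2 - x1 - x2 - ratr t).
Proof.
move=> o1 hs rx ry rl; rewrite (secant_prod _ o1 hs) subr_gt0.
apply: (@lt_le_trans _ _ 0).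
  have -> : ratr t ^+ 3 + ratr a * ratr t + ratr b = ratr (t ^+ 3 + a * t + b) :> algC by ring.
  by rewrite ltrq0.
have rt : ratr t \is @Num.real algC by apply: Creal_Crat; apply: Crat_rat.
by rewrite real_exprn_even_ge0 // rpredD ?rpredM ?rpredB.
Qed.

Lemma third_real x1 y1 x2 l : x1 \is Num.real -> y1 \is Num.real -> x2 \is Num.real ->
  l \is Num.real -> real_coords (third x1 y1 x2 l).
Proof. by move=> h1 h2 h3 h4; split; rewrite !(rpredB, rpredM, rpredX). Qed.

Lemma egg_add_identity P Q : on_curve a b P -> on_curve a b Q -> real_coords P -> real_coords Q ->
  on_egg P -> on_identity_component Q -> real_coords (ec_add a P Q) /\ on_egg (ec_add a P Q).
Proof.
case: P => [[x1 y1]|] //; case: Q => [[x2 y2]|]; last by move=> _ _ rP _ eP _; split.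
move=> o1 o2 [rx1 ry1] [rx2 ry2] h1 h2.
case: (@ec_add_field a b _ x1 y1 x2 y2 Creal_subfield) => // [[e _ _]|[l [rl hs ->]]].
  by move: (lt_trans h1 h2); rewrite e ltxx.
split; first exact: third_real.
have := third_sign o1 hs rx1 ry1 rl; rewrite nmulr_rgt0 ?subr_lt0 //.
by rewrite nmulr_rlt0 subr_cp0.
Qed.

Lemma egg_add_egg P Q : on_curve a b P -> on_curve a b Q -> real_coords P -> real_coords Q ->
  on_egg P -> on_egg Q -> real_coords (ec_add a P Q) /\ on_identity_component (ec_add a P Q).
Proof.
case: P => [[x1 y1]|] //; case: Q => [[x2 y2]|] // o1 o2 [rx1 ry1] [rx2 ry2] h1 h2.
case: (@ec_add_field a b _ x1 y1 x2 y2 Creal_subfield) => // [[_ _ ->]|[l [rl hs ->]]] //.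
split; first exact: third_real.
have := third_sign o1 hs rx1 ry1 rl; rewrite pmulr_rgt0 ?subr_gt0 //.
by rewrite nmulr_rgt0 subr_cp0.
Qed.

(** Modulo the identity component the real points form a group of order 2. Infinity is not on the
    egg, so odd multiples are nonzero. *)
Lemma egg_multiples (ns : nonsingular a b) (P : ecpt ns) n : real_coords P -> on_egg P ->
  real_coords (ecval (P *+ n)) /\
  (if odd n then on_egg (ecval (P *+ n)) else on_identity_component (ecval (P *+ n))).
Proof.
move=> rP eP; elim: n => [//|n [rn IH]]; rewrite mulrS val_ecptD /=.
have [oP on] := (ecptP P, ecptP (P *+ n)).
case: (odd n) IH => /= IH; first exact: egg_add_egg.
exact: egg_add_identity.
Qed.

End RealComponents.

Section AutAction.
Variables (a b : rat) (ns : nonsingular a b) (s : {rmorphism algC -> algC}).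

Definition aut_point (P : point) : point := if P is Some (x, y) then Some (s x, s y) else None.

Lemma aut_point_on P : on_curve a b P -> on_curve a b (aut_point P).
Proof.
case: P => [[x y]|] //= h; transitivity (s (y ^+ 2)); first by ring.
rewrite h; transitivity (s x ^+ 3 + s (ratr a) * s x + s (ratr b)); first by ring.
by rewrite !fmorph_rat.
Qed.

Lemma aut_point_add P Q : aut_point (ec_add a P Q) = ec_add a (aut_point P) (aut_point Q).
Proof.
have third_aut x1 y1 x2 l l' : l' = s l -> aut_point (third x1 y1 x2 l) = third (s x1) (s y1) (s x2) l'.
  by move=> ->; rewrite /third /=; congr Some; congr pair; ring.
case: P => [[x1 y1]|] //; case: Q => [[x2 y2]|] //=.
rewrite -rmorphN !fmorph_eq; case: ifP => _; [case: ifP => //= _|]; apply: third_aut.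
  by rewrite fmorph_div -{1}(fmorph_rat s); congr (_ / _); ring.
by rewrite fmorph_div; congr (_ / _); ring.
Qed.

Definition aut_ecpt (P : ecpt ns) : ecpt ns := mkpt ns (aut_point_on (ecptP P)).

Lemma aut_ecpt_is_additive : zmod_morphism aut_ecpt.
Proof.
have D P Q : aut_ecpt (P + Q) = aut_ecpt P + aut_ecpt Q.
  by apply: val_inj; apply: aut_point_add.
by move=> P Q; apply: (addIr (aut_ecpt Q)); rewrite -D !subrK.
Qed.

HB.instance Definition _ := GRing.isZmodMorphism.Build _ _ aut_ecpt aut_ecpt_is_additive.

Lemma aut_ecpt_rational P : coords_in Qfield (ecval P) -> aut_ecpt P = P.
Proof.
case: P => [[[x y]|] oP] h; apply: val_inj => //=.
by case: h => [[r ->] [r' ->]]; rewrite !fmorph_rat.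
Qed.

End AutAction.

Lemma odd_part n : (0 < n)%N -> exists i k, n = (k * 2 ^ i)%N /\ odd k.
Proof.
elim/ltn_ind: n => n IH n0; have [on|en] := boolP (odd n); first by exists 0%N, n; rewrite muln1.
have nE : n = (n./2).*2 by rewrite -[LHS]odd_double_half (negPf en).
have [||i [k [kE ok]]] := IH n./2.
- by rewrite [ltnRHS]nE -addnn -[ltnLHS]addn0 ltn_add2l; lia.
- by lia.
by exists i.+1, k; rewrite nE kE expnS -mul2n mulnCA.
Qed.

Section GainRank.
Variables e1 e2 e3 : int.
Hypotheses (n12 : e1 != e2) (n13 : e1 != e3) (n23 : e2 != e3).
Hypothesis esum : e1 + e2 + e3 = 0.
Let a : rat := (root_coefA e1 e2 e3)%:~R.
Let b : rat := (root_coefB e1 e2 e3)%:~R.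
Let ns : nonsingular a b := full_nonsingular n12 n13 n23 esum.
Variables (t : rat) (s : {rmorphism algC -> algC}) (K : algC -> Prop).
Hypothesis gap : t ^+ 3 + a * t + b < 0.
Hypothesis sK : is_subfield K.
Variables P1 P2 P3 : ecpt ns.
Local Notation act := (aut_ecpt s).
Hypotheses (act1 : act P1 = P2) (act2 : act P2 = P3) (act3 : act P3 = P1).
Hypothesis sum0 : P1 + P2 + P3 = 0.
Hypotheses (realP : real_coords (ecval P1)) (eggP : on_egg t (ecval P1)).
Hypothesis KP : coords_in K (ecval P1).

Lemma two_torsion_rational (T : ecpt ns) : T *+ 2 = 0 -> coords_in Qfield (ecval T).
Proof.
case: T => [[[x y]|] oP] //= h.
have {h} h : ec_add a (Some (x, y)) (Some (x, y)) = None.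
  by have := congr1 (fun R : ecpt ns => ecval R) h.
have y0 : y = 0.
  move: h => /=; rewrite eqxx; case: eqP => // e _.
  by apply/eqP; move/eqP: e; rewrite -addr_eq0 -mulr2n mulrn_eq0.
move/eqP: oP; rewrite y0 expr0n /=.
have -> : x ^+ 3 + ratr a * x + ratr b = (x - e1%:~R) * (x - e2%:~R) * (x - e3%:~R).
  rewrite /a /b /root_coefA /root_coefB !ratr_int.
  have -> : e3 = - e1 - e2 by rewrite -[LHS]addr0 -oppr0 -esum; ring.
  by ring.
move/esym/eqP; rewrite !mulf_eq0 !subr_eq0 => hx.
split; last by exists 0; rewrite rmorph0.
by case/orP: hx => [/orP[]|] /eqP ->; [exists e1%:~R|exists e2%:~R|exists e3%:~R]; rewrite ratr_int.
Qed.

(* V2 - V1 is a rational 2-torsion point, so the automorphism translates V1 by it;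
   as the automorphism has order 3 on V1, this translation is trivial. *)
Lemma halving_fixed (V1 V2 V3 : ecpt ns) : act V1 = V2 -> act V2 = V3 -> act V3 = V1 ->
  act (V1 *+ 2) = V1 *+ 2 -> V2 = V1.
Proof.
move=> h1 h2 h3; rewrite raddfMn /= h1 => h.
have T2 : (V2 - V1) *+ 2 = 0 by rewrite mulrnBl h subrr.
have := aut_ecpt_rational s (two_torsion_rational T2); rewrite raddfB /= h1 h2 => e.
have V31 : V3 = V1.
  apply/eqP; rewrite -subr_eq0; apply/eqP; rewrite -T2 mulr2n -{1}e.
  by rewrite addrA subrK.
by rewrite -h1 -[in LHS]V31 h3.
Qed.

Lemma fixed_descend i (V1 V2 V3 : ecpt ns) : act V1 = V2 -> act V2 = V3 -> act V3 = V1 ->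
  act (V1 *+ 2 ^ i) = V1 *+ 2 ^ i -> V2 = V1.
Proof.
elim: i V1 V2 V3 => [|i IH] V1 V2 V3 h1 h2 h3; first by rewrite mulr1n h1.
rewrite expnS mulrnA => h; apply: (halving_fixed h1 h2 h3).
have {}IH := IH (V1 *+ 2) (V2 *+ 2) (V3 *+ 2).
rewrite raddfMn /= h1; apply: IH; last exact: h.
- by rewrite raddfMn /= h1.
- by rewrite raddfMn /= h2.
- by rewrite raddfMn /= h3.
Qed.

Lemma no_fixed_multiple (k : int) : act (P1 *~ k) = P1 *~ k -> k = 0.
Proof.
move=> h; apply/eqP; apply: contraT => k0.
have actM (x : ecpt ns) : act (x *~ k) = act x *~ k by exact: raddfMz.
have h1 : P2 *~ k = P1 *~ k by rewrite -act1 -actM.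
have h2 : P3 *~ k = P1 *~ k by rewrite -act2 -actM h1.
have tor : P1 *~ k *~ 3 = 0.
  have := congr1 (fun R => R *~ k) sum0; rewrite mul0rz !mulrzDl h1 h2 => <-.
  by rewrite -[3]/(3%N : int) -pmulrn !mulrS mulr0n addr0 addrA.
have [n n0 torn] : exists2 n, (0 < n)%N & P1 *+ n = 0.
  exists (absz (k * 3)); first by rewrite absz_gt0 mulf_neq0.
  move: tor; rewrite -mulrzA; case: (k * 3) => m; first by [].
  by rewrite NegzE mulrNz => /eqP; rewrite oppr_eq0 => /eqP.
(* [q P1] has 2-power order, hence is fixed; then [3 q P1 = 0] with [3 q] odd, which the egg
   forbids. *)
have [i [q [nE oq]]] := odd_part n0.
pose S1 := P1 *+ q; pose S2 := P2 *+ q; pose S3 := P3 *+ q.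
have a1 : act S1 = S2 by rewrite raddfMn /= act1.
have a2 : act S2 = S3 by rewrite raddfMn /= act2.
have a3 : act S3 = S1 by rewrite raddfMn /= act3.
have S21 : S2 = S1.
  by apply: (@fixed_descend i _ _ _ a1 a2 a3); rewrite -mulrnA -nE torn raddf0.
have S31 : S3 = S1 by rewrite -a2 S21 a1.
have : P1 *+ (q * 3) = 0.
  have := congr1 (fun R => R *+ q) sum0; rewrite mul0rn !mulrnDl -/S1 -/S2 -/S3 S21 S31 => <-.
  by rewrite mulrnA -/S1 !mulrS mulr0n addr0 addrA.
have [_] := egg_multiples gap (q * 3) realP eggP.
by rewrite oddM oq /= => + e; rewrite e.
Qed.

Lemma rational_rank_bound : exists r, rank_ge a b Qfield r /\ ~ rank_ge a b Qfield r.+1.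
Proof.
have [S hS] := finite_generation n12 n13 n23 esum.
have big : ~ rank_ge a b Qfield (size S).+1.
  move=> /(rank_geP ns)[P [QP iP]].
  have := indep_in_span (fun i => hS (P i) (QP i)) iP.
  by rewrite ltnn.
(* Without a largest rank, induction from the empty family would reach every rank. *)
apply: NNPP => no; apply: big; elim: (size S).+1 => [|n IH].
  by exists (fun=> None); split=> // c _ [].
by apply: NNPP => h; apply: no; exists n.
Qed.

Lemma gains_rank_of_egg : gains_rank a b K.
Proof.
have [r [hr nr]] := rational_rank_bound.
exists r.+1; split=> //; apply/(rank_geP ns).
have [R [QR iR]] := (rank_geP ns Qfield r).1 hr.
pose P i := if unlift ord0 i is Some j then R j else P1.
exists P; split.
  move=> i; rewrite /P; case: (unlift _ _) => [j|] //.
  move: (QR j); case: (ecval (R j)) => [[x y]|] //= [[x' ->] [y' ->]].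
  by split; apply: subfield_rat.
move=> c; rewrite big_ord_recl {1}/P unlift_none.
under eq_bigr => j _ do rewrite /P liftK.
move=> e.
have c0 : c ord0 = 0.
  apply: no_fixed_multiple.
  have -> : P1 *~ c ord0 = - (\sum_j R j *~ c (lift ord0 j)).
    by apply/eqP; rewrite -addr_eq0 e.
  rewrite raddfN raddf_sum /=; congr (- _); apply: eq_bigr => j _.
  have -> : act (R j *~ c (lift ord0 j)) = act (R j) *~ c (lift ord0 j) by exact: raddfMz.
  by rewrite aut_ecpt_rational.
have cj := iR (fun j => c (lift ord0 j)).
move=> i; case: (unliftP ord0 i) => [j ->|-> //].
by apply: cj; move: e; rewrite c0 mulr0z add0r.
Qed.

End GainRank.

(** * The family of curves *)

(* The curve Y^2 = X^3 + (N X + B^2)^2, whose 2-torsion lies at X = - B^2,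
   - (u + 1)^2 and - u^2, is shifted by x = X + c into short Weierstrass form.
   Its intersection with the line Y = N X + B^2 + 2 e, where e = E / n, is
   X^3 = 4 e (N X + B^2 + e); the cubic T^3 + p T + q below is the equation of
   n X, and fam_d is the square root of its discriminant. The value of e comes
   from the rational parametrization (by k) of the conic
   z^2 + 27 (e - B^2)^2 = 4 D^2 e, which says that this discriminant is a square. *)
Section Family.
Variables u c : int.
Hypothesis u_ge4 : 4 <= u.
Let N : int := u ^+ 2 + u + 1.
Let B : int := u * (u + 1).
Let D : int := (u - 1) * (2 * u + 1) * (u + 2).
Hypothesis hE : 3 * c = N ^+ 2.

Definition fam_e1 : int := c - B ^+ 2.
Definition fam_e2 : int := c - (u + 1) ^+ 2.
Definition fam_e3 : int := c - u ^+ 2.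

Lemma family_sum0 : fam_e1 + fam_e2 + fam_e3 = 0.
Proof.
have -> : fam_e1 + fam_e2 + fam_e3 = 3 * c - (B ^+ 2 + (u + 1) ^+ 2 + u ^+ 2) by rewrite /fam_e1 /fam_e2 /fam_e3; ring.
by rewrite hE /N /B; ring.
Qed.

Lemma family_neq12 : fam_e1 != fam_e2.
Proof. rewrite -subr_eq0 /fam_e1 /fam_e2 /B; apply/eqP; nia. Qed.
Lemma family_neq13 : fam_e1 != fam_e3.
Proof. rewrite -subr_eq0 /fam_e1 /fam_e3 /B; apply/eqP; nia. Qed.
Lemma family_neq23 : fam_e2 != fam_e3.
Proof. rewrite -subr_eq0 /fam_e2 /fam_e3; apply/eqP; nia. Qed.

Lemma norm_identity : 4 * N ^+ 3 = D ^+ 2 + 27 * B ^+ 2.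
Proof. by rewrite /N /D /B; ring. Qed.

(** The line [z = 2 D B + k (e - B^2)] meets the conic again at [e = B^2 + 4 D (D - B k) / n], that
    is [E / n]. *)
Definition fam_n (k : int) : int := k ^+ 2 + 27.
Definition fam_E (k : int) : int := (B * k - 2 * D) ^+ 2 + 27 * B ^+ 2.
Definition fam_p k : int := - 4 * fam_n k * fam_E k * N.
Definition fam_q k : int := - 4 * fam_n k * fam_E k * (fam_n k * B ^+ 2 + fam_E k).
Definition fam_d k : int := 8 * fam_n k * fam_E k * D * (27 * B + 2 * k * D - B * k ^+ 2).

Lemma fam_disc k : fam_d k ^+ 2 = - 4 * fam_p k ^+ 3 - 27 * fam_q k ^+ 2.
Proof.
have e : 16 * fam_n k * fam_E k * N ^+ 3 - 27 * (fam_n k * B ^+ 2 + fam_E k) ^+ 2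
   = (2 * D * (27 * B + 2 * k * D - B * k ^+ 2)) ^+ 2.
  transitivity (4 * fam_n k * fam_E k * (4 * N ^+ 3) - 27 * (fam_n k * B ^+ 2 + fam_E k) ^+ 2); first by ring.
  by rewrite norm_identity /fam_n /fam_E; ring.
rewrite /fam_d /fam_p /fam_q.
transitivity ((4 * fam_n k * fam_E k) ^+ 2 * (2 * D * (27 * B + 2 * k * D - B * k ^+ 2)) ^+ 2); first by ring.
by rewrite -e; ring.
Qed.

Let Npos : 0 < N. Proof. rewrite /N; nia. Qed.
Let Bpos : 0 < B. Proof. rewrite /B; nia. Qed.
Let Dpos : 0 < D. Proof. rewrite /D; nia. Qed.
Lemma fam_n_gt0 k : 0 < fam_n k. Proof. rewrite /fam_n; nia. Qed.
Lemma fam_E_gt0 k : 0 < fam_E k.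
Proof. by rewrite /fam_E ltr_wpDl ?sqr_ge0 // mulr_gt0 // exprn_gt0. Qed.

(** A prime not dividing a multiple of this number divides none of the constants in the coprimality
    arguments; the factor [6 D] also makes [k] large. *)
Definition fam_M : nat := absz (6 * D * N * B).
(* The prime p divides k^2 + 27 exactly once for k = 27 M or for k = 27 M + p. *)
Definition fam_k (M : nat) : nat :=
  let p := pdiv (27 * M ^ 2 + 1) in
  if (p ^ 2 %| (27 * M) ^ 2 + 27)%N then 27 * M + p else 27 * M.

Lemma fam_k_spec (M : nat) : (0 < M)%N -> (2 %| M)%N -> exists P : nat,
  [/\ prime P, ~~ (P %| M)%N, (P %| fam_k M ^ 2 + 27)%N & ~~ (P ^ 2 %| fam_k M ^ 2 + 27)%N].
Proof.
move=> M0 M2; set Q := (27 * M ^ 2 + 1)%N; pose P := pdiv Q.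
have prP : prime P by apply: pdiv_prime; rewrite /Q addn1 ltnS muln_gt0 expn_gt0 M0.
have PQ : (P %| Q)%N := pdiv_dvd Q.
have QE : ((27 * M) ^ 2 + 27 = 27 * Q)%N by rewrite /Q; lia.
have P27M : ~~ (P %| 27 * M ^ 2)%N.
  apply/negP => h; have : (P %| 1)%N by rewrite -(dvdn_addr _ h).
  by rewrite dvdn1 => /eqP P1; rewrite P1 in prP.
have PM : ~~ (P %| M)%N by apply: contra P27M => h; rewrite dvdn_mull // dvdn_exp.
exists P; split=> //; rewrite /fam_k -/Q -/P; case: ifP => h.
- have -> : ((27 * M + P) ^ 2 + 27 = 27 * Q + P * (54 * M + P))%N by rewrite -QE; lia.
  by apply: dvdn_add; [apply: dvdn_mull | apply: dvdn_mulr].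
- by rewrite QE dvdn_mull.
(* The shift by [P] adds [P (54 M + P)], which [P^2] does not divide, as [P] is prime to 2, 3 and
   [M]. *)
- have -> : ((27 * M + P) ^ 2 + 27 = ((27 * M) ^ 2 + 27) + P * (54 * M + P))%N by lia.
  rewrite (dvdn_addr _ h) -mulnn dvdn_pmul2l ?prime_gt0 // dvdn_addl //.
  rewrite (_ : 54 = 2 * 27)%N // -mulnA !Euclid_dvdM // (negPf PM) orbF.
  apply/norP; split; last by apply: contra P27M => h'; rewrite dvdn_mulr.
  by apply: contra PM => h'; apply: dvdn_trans h' M2.
by rewrite h.
Qed.

Lemma fam_k_ramified (M : nat) : (0 < M)%N -> (fam_M %| M)%N ->
  let k := (fam_k M)%:Z in fam_d k != 0 /\ exists P : nat,
  [/\ prime P, ~~ (P %| M)%N, (P%:Z %| fam_p k)%Z, (P%:Z %| fam_q k)%Z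
     & ~~ (P%:Z ^+ 2 %| fam_q k)%Z].
Proof.
move=> M0 MM k.
have M2 : (2 %| M)%N.
  by apply: dvdn_trans MM; rewrite /fam_M !abszM -!mulnA dvdn_mulr.
have [P [prP PM Pn Pn2]] := fam_k_spec M0 M2.
have prD (x y : int) : (P%:Z %| x * y)%Z -> (P%:Z %| x)%Z || (P%:Z %| y)%Z.
  by rewrite !dvdzE abszM Euclid_dvdM.
have ndv (x y : int) : x * y = 6 * D * N * B -> ~~ (P%:Z %| x)%Z.
  move=> e; apply: contra PM => Px; apply: dvdn_trans MM; rewrite /fam_M -e.
  by rewrite -[P]/(absz P%:Z) -dvdzE dvdz_mulr.
have P2 : ~~ (P%:Z %| 2)%Z by apply: (@ndv _ (3 * D * N * B)); ring.
have P3 : ~~ (P%:Z %| 3)%Z by apply: (@ndv _ (2 * D * N * B)); ring.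
have PD : ~~ (P%:Z %| D)%Z by apply: (@ndv _ (6 * N * B)); ring.
have PN : ~~ (P%:Z %| N)%Z by apply: (@ndv _ (6 * D * B)); ring.
have P4 : ~~ (P%:Z %| 4)%Z by apply/negP => /(prD 2 2); rewrite (negPf P2).
have nE : fam_n k = (fam_k M ^ 2 + 27)%N%:Z by rewrite /fam_n /k; lia.
have Pn' : (P%:Z %| fam_n k)%Z by rewrite nE dvdzE.
have P4N : ~~ (P%:Z %| 4 * N ^+ 3)%Z.
  by apply/negP => /prD /orP[|/prD /orP[|/prD /orP[]]]; apply/negP.
(* Modulo [P], where [n] vanishes, [E = - 4 D (B k - D)] and [4 N^3 = - (B k + D) (B k - D)]; so [P]
   would divide [4 N^3]. *)
have PE : ~~ (P%:Z %| fam_E k)%Z.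
  apply/negP => h; have h1 : (P%:Z %| 4 * (D * (B * k - D)))%Z.
    have -> : 4 * (D * (B * k - D)) = B ^+ 2 * fam_n k - fam_E k by rewrite /fam_E /fam_n; ring.
    by rewrite rpredB // dvdz_mull.
  have h2 : (P%:Z %| B * k - D)%Z.
    by move: h1 => /prD; rewrite (negPf P4) /= => /prD; rewrite (negPf PD).
  case/negP: P4N.
  have -> : 4 * N ^+ 3 = B ^+ 2 * fam_n k - (B * k + D) * (B * k - D).
    by rewrite norm_identity /fam_n; ring.
  by rewrite rpredB // dvdz_mull.
have PE' : ~~ (P%:Z %| fam_n k * B ^+ 2 + fam_E k)%Z.
  by rewrite rpredDl // dvdz_mulr.
(* Modulo [P] this is [2 (27 B + k D)], and [(27 B + k D) (27 B - k D)] is [27] times [4 N^3]. *)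
have L0 : 27 * B + 2 * k * D - B * k ^+ 2 != 0.
  apply: contraNneq P4N => h.
  have h1 : (P%:Z %| 2 * (27 * B + k * D))%Z.
    have -> : 2 * (27 * B + k * D) = (27 * B + 2 * k * D - B * k ^+ 2) + B * fam_n k.
      by rewrite /fam_n; ring.
    by rewrite h add0r dvdz_mull.
  have h2 : (P%:Z %| 27 * B + k * D)%Z by move: h1 => /prD; rewrite (negPf P2).
  have h3 : (P%:Z %| 3 * (3 * (3 * (4 * N ^+ 3))))%Z.
    have -> : 3 * (3 * (3 * (4 * N ^+ 3))) = (27 * B + k * D) * (27 * B - k * D) + D ^+ 2 * fam_n k.
      by rewrite norm_identity /fam_n; ring.
    by rewrite rpredD // ?(dvdz_mulr _ h2) ?dvdz_mull.
  by move: h3 => /prD; rewrite (negPf P3) /= => /prD; rewrite (negPf P3) /= => /prD; rewrite (negPf P3).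
split.
  rewrite /fam_d; apply: mulf_neq0 L0; apply: mulf_neq0 (lt0r_neq0 Dpos).
  apply: mulf_neq0 (lt0r_neq0 (fam_E_gt0 k)); exact: mulf_neq0 (lt0r_neq0 (fam_n_gt0 k)).
exists P; split=> //.
- by rewrite /fam_p -mulrA dvdz_mulr // dvdz_mull.
- by rewrite /fam_q -!mulrA mulrCA dvdz_mulr.
apply: contra Pn2 => h; rewrite -[(_ + _)%N]/(absz (_ + _)%N%:Z) -nE.
have : (P%:Z ^+ 2 %| fam_n k)%Z; last by rewrite dvdzE abszX.
have co : coprimez (P%:Z ^+ 2) (- 4 * fam_E k * (fam_n k * B ^+ 2 + fam_E k)).
  rewrite coprimezXl // coprimezE /= prime_coprime // -[P]/(absz P%:Z) -dvdzE.
  by apply/negP => /prD /orP[/prD /orP[|]|]; rewrite ?rpredN; apply/negP.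
rewrite -(Gauss_dvdzr _ co); move: h; rewrite /fam_q.
by rewrite (_ : _ * fam_n k = - 4 * fam_n k * fam_E k * (fam_n k * B ^+ 2 + fam_E k)) //; ring.
Qed.

Lemma fam_k_ge (M : nat) : (0 < M)%N -> (fam_M %| M)%N -> 4 * D <= (fam_k M)%:Z.
Proof.
move=> M0 MM; have := dvdn_leq M0 MM.
have le27 : (27 * M <= fam_k M)%N by rewrite /fam_k; case: ifP => // _; rewrite leq_addr.
have -> : fam_M = (6 * absz D * absz N * absz B)%N by rewrite /fam_M !abszM.
have n0 : (0 < absz N)%N by rewrite absz_gt0 gt_eqF.
have b0 : (0 < absz B)%N by rewrite absz_gt0 gt_eqF.
move=> h; have : (6 * absz D <= M)%N.
  by apply: leq_trans h; rewrite -mulnA leq_pmulr // muln_gt0 n0.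
have : (absz D)%:Z = D by rewrite gez0_abs // ltW.
by move: le27; lia.
Qed.

Lemma fam_E_ge k : 4 * D <= k -> fam_n k * B ^+ 2 <= 4 * fam_E k.
Proof.
move=> hk; have B1 : 1 <= B by rewrite -gtz0_ge1.
have h1 : 0 <= B * k - 4 * D.
  by rewrite subr_ge0 (le_trans hk) // ler_peMl // (le_trans _ hk) // mulr_ge0 // ltW.
have h2 : 0 <= (B * k - 4 * D) * (3 * B * k - 4 * D).
  rewrite mulr_ge0 //; have -> : 3 * B * k - 4 * D = (B * k - 4 * D) + 2 * (B * k) by ring.
  rewrite addr_ge0 // mulr_ge0 // mulr_ge0 ?(ltW Bpos) //.
  by rewrite (le_trans _ hk) // mulr_ge0 // ltW.
rewrite -subr_ge0.
have -> : 4 * fam_E k - fam_n k * B ^+ 2 = (B * k - 4 * D) * (3 * B * k - 4 * D) + 81 * B ^+ 2.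
  by rewrite /fam_E /fam_n; ring.
by rewrite addr_ge0 // mulr_ge0 // exprn_ge0 // ltW.
Qed.

(** The roots sum to zero. If all were at least [- n B], the second symmetric function of the
    [w_i + n B], which is [3 (n B)^2 + p], would be nonnegative; [fam_E_ge] and [3 < N] make it
    negative. The boolean form lets [sigW] choose the root later. *)
Lemma fam_egg k : 4 * D <= k -> fam_d k != 0 -> exists w : algC,
  [&& w ^+ 3 + (fam_p k)%:~R * w + (fam_q k)%:~R == 0, w \is Num.real & w < - (fam_n k * B)%:~R].
Proof.
move=> hk d0; set p := fam_p k; set q := fam_q k; set d := fam_d k in d0 *.
have dE : d ^+ 2 = - 4 * p ^+ 3 - 27 * q ^+ 2 := fam_disc k.
have [w0 rw0] : exists w : algC, is_root p q w.
  have /closed_rootP[w rw] : size ('X^3 + (p%:~R)%:P * 'X + (q%:~R)%:P : {poly algC})%R != 1%N.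
    rewrite -addrA size_polyDl size_polyXn //.
    by rewrite size_MXaddC; case: ifP => // _; rewrite !ltnS (leq_trans (size_polyC_leq1 _)).
  by exists w; move: rw; rewrite /root !hornerE => /eqP.
(* Complex conjugation permutes the roots, has order at most 2 and commutes with their 3-cycle, so
   it fixes them. *)
have real (w : algC) : is_root p q w -> w \is Num.real.
  move=> rw; have rcw : is_root p q (w^*).
    rewrite /is_root; transitivity ((w ^+ 3 + p%:~R * w + q%:~R)^*); first by ring.
    by rewrite rw rmorph0.
  have cm (v : algC) : (conj3 p q d v)^* = conj3 p q d v^* by apply: conj3_morph.
  rewrite CrealE; case: (conj3_roots d0 dE rw rcw) => e.
  - by rewrite e.
  - have e2 : w = conj3 p q d (conj3 p q d w) by rewrite -[LHS]conjCK e cm e.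
    by have := conj3_neq d0 dE rw; rewrite {1}e2 (conj3_3 d0 dE rw) eqxx.
  have e2 : w = conj3 p q d w.
    by rewrite -[LHS]conjCK e !cm e (conj3_3 d0 dE (conj3_root d0 dE rw)).
  by have := conj3_neq d0 dE rw; rewrite -e2 eqxx.
pose w1 := conj3 p q d w0; pose w2 := conj3 p q d w1.
have rw1 : is_root p q w1 := conj3_root d0 dE rw0.
have rw2 : is_root p q w2 := conj3_root d0 dE rw1.
pose b : algC := (fam_n k * B)%:~R.
have rb : b \is Num.real by rewrite /b rpred_int.
have [h0|h0] := boolP (w0 < - b); first by exists w0; rewrite rw0 eqxx real.
have [h1|h1] := boolP (w1 < - b); first by exists w1; rewrite rw1 eqxx real.
have [h2|h2] := boolP (w2 < - b); first by exists w2; rewrite rw2 eqxx real.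
exfalso.
have ge (w : algC) : is_root p q w -> ~~ (w < - b) -> 0 <= w + b.
  move=> rw hn; have : - b <= w by rewrite real_leNgt ?rpredN // real.
  by rewrite -subr_ge0 opprK.
have g0 := ge _ rw0 h0; have g1 := ge _ rw1 h1; have g2 := ge _ rw2 h2.
have sum0 : w2 = - w0 - w1 := conj3_2 d0 dE rw0.
have q2 : w1 ^+ 2 + w0 * w1 + w0 ^+ 2 + p%:~R = 0 := conj3_quadratic d0 dE rw0.
have : 0 <= (w0 + b) * (w1 + b + (w2 + b)) + (w1 + b) * (w0 + b + (w2 + b)) + (w2 + b) * (w0 + b + (w1 + b)).
  by rewrite !addr_ge0 // mulr_ge0 // addr_ge0.
have -> : (w0 + b) * (w1 + b + (w2 + b)) + (w1 + b) * (w0 + b + (w2 + b)) + (w2 + b) * (w0 + b + (w1 + b))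
   = (6 * (fam_n k * B) ^+ 2 + 2 * p)%:~R.
  transitivity (6 * b ^+ 2 + 2 * p%:~R - 2 * (w1 ^+ 2 + w0 * w1 + w0 ^+ 2 + p%:~R)).
    by rewrite sum0; ring.
  by rewrite q2 /b; ring.
rewrite ler0z; apply/negP; rewrite -ltNge.
have := fam_E_ge hk; have := fam_n_gt0 k; have := fam_E_gt0 k; rewrite /p /fam_p.
set n := fam_n k; set E := fam_E k => E0 n0 nE.
have N3 : 3 < N by rewrite /N; nia.
have key : 0 < (4 * E - n * B ^+ 2) * N + n * B ^+ 2 * (N - 3).
  apply: ltr_wpDl; first by apply: mulr_ge0; [rewrite subr_ge0 | exact: ltW].
  by apply: mulr_gt0; [apply: mulr_gt0 => //; apply: exprn_gt0 | rewrite subr_gt0].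
have -> : 6 * (n * B) ^+ 2 + 2 * (- 4 * n * E * N) =
   - (2 * n * ((4 * E - n * B ^+ 2) * N + n * B ^+ 2 * (N - 3))) by ring.
by rewrite oppr_lt0 mulr_gt0 // mulr_gt0.
Qed.

Let r1 := fam_e1. Let r2 := fam_e2. Let r3 := fam_e3.
Definition fam_a : rat := (root_coefA r1 r2 r3)%:~R.
Definition fam_b : rat := (root_coefB r1 r2 r3)%:~R.
Let ns : nonsingular fam_a fam_b :=
  full_nonsingular family_neq12 family_neq13 family_neq23 family_sum0.

Let Bgt1 : 1 < B. Proof. rewrite /B; nia. Qed.

(** [- B = - u (u + 1)] lies between the roots [- (u + 1)^2] and [- u^2]. *)
Lemma fam_gap : (c - B)%:~R ^+ 3 + fam_a * (c - B)%:~R + fam_b < 0.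
Proof.
rewrite (full_split family_sum0).
have -> : ((c - B)%:~R - r1%:~R) * ((c - B)%:~R - r2%:~R) * ((c - B)%:~R - r3%:~R) =
   (- (B * (B - 1) * (u + 1) * u))%:~R :> rat.
  by rewrite /r1 /r2 /r3 /fam_e1 /fam_e2 /fam_e3 /B; ring.
rewrite ltrz0 oppr_lt0; apply: mulr_gt0; last by lia.
by apply: mulr_gt0; [apply: mulr_gt0 => //; rewrite subr_gt0 | lia].
Qed.

Section Point.
Variable k : int.
Hypothesis d0 : fam_d k != 0.
Let n := fam_n k. Let E := fam_E k. Let p := fam_p k. Let q := fam_q k. Let d := fam_d k.
Let nC : n%:~R != 0 :> algC. Proof. by rewrite intr_eq0 lt0r_neq0 // fam_n_gt0. Qed.

Definition fam_point (w : algC) : point :=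
  Some (w / n%:~R + c%:~R, (N%:~R * w + 2 * E%:~R) / n%:~R + B%:~R ^+ 2).

Lemma fam_point_on w : is_root p q w -> on_curve fam_a fam_b (fam_point w).
Proof.
move=> rw; rewrite /= /fam_a /fam_b !ratr_int.
have w3 : w ^+ 3 = - (p%:~R * w + q%:~R) by apply/eqP; rewrite -addr_eq0 addrA; apply/eqP.
set X := w / n%:~R.
transitivity ((N%:~R * X + B%:~R ^+ 2) ^+ 2 + X ^+ 3 : algC).
  transitivity ((N%:~R * X + B%:~R ^+ 2) ^+ 2 + w ^+ 3 / n%:~R ^+ 3 : algC); last first.
    by rewrite /X expr_div_n.
  by rewrite w3 /X /p /q /fam_p /fam_q -/n -/E; field.
have e : ((root_coefA r1 r2 r3)%:~R : algC) * (X + c%:~R) + (root_coefB r1 r2 r3)%:~R + (X + c%:~R) ^+ 3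
   = (X + c%:~R - r1%:~R) * (X + c%:~R - r2%:~R) * (X + c%:~R - r3%:~R).
  rewrite /root_coefA /root_coefB; have -> : r3 = - r1 - r2.
    by rewrite -[LHS]addr0 -oppr0 -family_sum0 -/r1 -/r2 -/r3; ring.
  by ring.
rewrite -addrA addrC e /r1 /r2 /r3 /fam_e1 /fam_e2 /fam_e3 /N /B; ring.
Qed.

(** The conjugate points lie on a line of slope [N]; the shift [c] with [N^2 = 3 c] is what matches
    the third abscissa to [- w - conj3 w]. *)
Lemma fam_point_collinear w : is_root p q w ->
  ec_add fam_a (fam_point w) (fam_point (conj3 p q d w)) =
  ec_neg (fam_point (conj3 p q d (conj3 p q d w))).
Proof.
move=> rw; have dE : d ^+ 2 = - 4 * p ^+ 3 - 27 * q ^+ 2 := fam_disc k.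
have nw : conj3 p q d w - w != 0 by rewrite subr_eq0 (conj3_neq d0 dE rw).
rewrite (conj3_2 d0 dE rw); set v := conj3 p q d w in nw *.
rewrite /fam_point ec_add_chord; last first.
  by apply: contraNneq nw => /addIr /(mulIf (invr_neq0 nC)) ->; rewrite subrr.
have -> : ((N%:~R * v + 2 * E%:~R) / n%:~R + B%:~R ^+ 2 - ((N%:~R * w + 2 * E%:~R) / n%:~R + B%:~R ^+ 2)) /
  (v / n%:~R + c%:~R - (w / n%:~R + c%:~R)) = N%:~R.
  have h : v / n%:~R + c%:~R - (w / n%:~R + c%:~R) = (v - w) / n%:~R by ring.
  by rewrite h; field; rewrite nw nC.
have N2 : N%:~R ^+ 2 = 3 * c%:~R :> algC by rewrite -rmorphXn -hE; ring.
have x3 : N%:~R ^+ 2 - (w / n%:~R + c%:~R) - (v / n%:~R + c%:~R) = (- w - v) / n%:~R + c%:~R :> algC.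
  by rewrite N2; ring.
rewrite /third x3 /=; congr Some; congr pair.
by ring.
Qed.

Lemma fam_point_coords F w : is_subfield F -> F w -> coords_in F (fam_point w).
Proof.
move=> sF Fw; have int m : F m%:~R := subfield_int sF m.
have nV : F n%:~R^-1 by apply: (subfieldV sF); exact: int.
split.
  by apply: (subfieldD sF); last exact: int; apply: (subfieldM sF).
apply: (subfieldD sF); last by apply: (subfieldX sF); exact: int.
apply: (subfieldM sF); last exact: nV.
by apply: (subfieldD sF); apply: (subfieldM sF) => //; try exact: int; exact: (int 2).
Qed.

Lemma fam_gains_rank w : is_root p q w -> w \is Num.real -> w < - (n * B)%:~R ->
  ~ field_gen [::] w -> gains_rank fam_a fam_b (field_gen [:: w]).
Proof.
move=> rw realw ltw wQ; have dE : d ^+ 2 = - 4 * p ^+ 3 - 27 * q ^+ 2 := fam_disc k.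
have [t [_ tw]] := field_gen_aut d0 dE rw wQ.
pose w1 := conj3 p q d w; pose w2 := conj3 p q d w1.
have rw1 : is_root p q w1 := conj3_root d0 dE rw.
have rw2 : is_root p q w2 := conj3_root d0 dE rw1.
have w3 : conj3 p q d w2 = w := conj3_3 d0 dE rw.
have tpt v : aut_point t (fam_point v) = fam_point (t v).
  have tX x : t (x / n%:~R) = t x / n%:~R by rewrite fmorph_div rmorph_int.
  rewrite /fam_point /=; congr Some; congr pair.
    by transitivity (t (v / n%:~R) + c%:~R); [ring | rewrite tX].
  transitivity (t ((N%:~R * v + 2 * E%:~R) / n%:~R) + B%:~R ^+ 2); first by ring.
  by rewrite tX; congr (_ / _ + _); ring.
pose P v (r : is_root p q v) : ecpt ns := mkpt ns (fam_point_on r).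
have sK := field_gen_subfield [:: w].
have Kw : field_gen [:: w] w by apply: mem_field_gen; rewrite inE.
apply: (@gains_rank_of_egg _ _ _ family_neq12 family_neq13 family_neq23 family_sum0
  (c - B)%:~R t (field_gen [:: w]) fam_gap sK (P w rw) (P w1 rw1) (P w2 rw2)).
- by apply: val_inj; rewrite /= -[LHS]/(aut_point t (fam_point w)) tpt tw.
- by apply: val_inj; rewrite /= -[LHS]/(aut_point t (fam_point w1)) tpt /w1 conj3_morph tw.
- apply: val_inj; rewrite /= -[LHS]/(aut_point t (fam_point w2)) tpt /w2 /w1 !conj3_morph tw.
  by rewrite -/w1 -/w2 w3.
- apply/eqP; rewrite addr_eq0; apply/eqP; apply: val_inj; exact: fam_point_collinear.
- exact: (fam_point_coords Creal_subfield).
- rewrite /= ratr_int rmorphB /= addrC ltrD2l.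
  have n0 : 0 < n%:~R :> algC by rewrite ltr0z fam_n_gt0.
  by rewrite ltr_pdivrMr // mulNr; move: ltw; rewrite (mulrC n B) rmorphM.
exact: fam_point_coords.
Qed.

End Point.

(* Each parameter is chosen so that its field ramifies at a prime dividing none of
   the previous discriminants. *)
Fixpoint fam_Mseq (i : nat) : nat :=
  if i is j.+1 then fam_Mseq j * absz (fam_d (fam_k (fam_Mseq j))) else fam_M.

Lemma fam_M_gt0 : (0 < fam_M)%N.
Proof.
rewrite absz_gt0; apply: mulf_neq0 (lt0r_neq0 Bpos).
by apply: mulf_neq0 (lt0r_neq0 Npos); apply: mulf_neq0 (lt0r_neq0 Dpos).
Qed.

Lemma fam_Mseq_ok i : (0 < fam_Mseq i)%N /\ (fam_M %| fam_Mseq i)%N.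
Proof.
elim: i => [|i [IH1 IH2]] /=; first by rewrite fam_M_gt0.
have [d0 _] := fam_k_ramified IH1 IH2.
by rewrite muln_gt0 IH1 absz_gt0 d0 dvdn_mulr.
Qed.

Lemma fam_Mseq_dvd i j : (i < j)%N -> (absz (fam_d (fam_k (fam_Mseq i))) %| fam_Mseq j)%N.
Proof.
elim: j => // j IH; rewrite ltnS leq_eqVlt => /orP[/eqP ->|/IH h] /=; first exact: dvdn_mull.
exact: dvdn_mulr.
Qed.

Lemma fam_cubic_fields : exists K : nat -> algC -> Prop,
  [/\ (forall m, cyclic_cubic (K m)), linearly_disjoint K &
       forall m, gains_rank fam_a fam_b (K m)].
Proof.
pose k i : int := fam_k (fam_Mseq i).
have ram i := fam_k_ramified (proj1 (fam_Mseq_ok i)) (proj2 (fam_Mseq_ok i)).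
have d0 i : fam_d (k i) != 0 by case: (ram i).
have ek i := fam_egg (fam_k_ge (proj1 (fam_Mseq_ok i)) (proj2 (fam_Mseq_ok i))) (d0 i).
pose w i := sval (sigW (ek i)).
have wP i : [/\ is_root (fam_p (k i)) (fam_q (k i)) (w i), w i \is Num.real
     & w i < - (fam_n (k i) * B)%:~R].
  by have /and3P[/eqP h1 h2 h3] := svalP (sigW (ek i)).
have rw i : is_root (fam_p (k i)) (fam_q (k i)) (w i) by case: (wP i).
have hP m : exists P : nat, [/\ prime P, (P%:Z %| fam_p (k m))%Z, (P%:Z %| fam_q (k m))%Z,
     ~~ (P%:Z ^+ 2 %| fam_q (k m))%Z & forall i, (i < m)%N -> ~~ (P%:Z %| fam_d (k i))%Z].
  have [_ [P [prP PM Pp Pq Pq2]]] := ram m; exists P; split=> // i im.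
  by apply: contra PM; rewrite dvdzE => h; apply: dvdn_trans h (fam_Mseq_dvd im).
have [cyc dis] := linearly_disjoint_cubics d0 (fun i => fam_disc (k i)) rw hP.
exists (fun m => field_gen [:: w m]); split=> // m.
have [_ realw ltw] := wP m.
apply: (fam_gains_rank (d0 m) (rw m) realw ltw).
have [P [prP Pp Pq Pq2 _]] := hP m.
exact: (ramified_not_in (d0 m) (fam_disc (k m)) (rw m) prP Pp Pq Pq2).
Qed.

End Family.

(** * The j-invariants *)

Definition fam_ratio (u : int) : rat := (2 * u + 1)%:~R / ((u + 1) ^+ 3 * (u - 1))%:~R.

Lemma fam_ratio_gt0 u : 4 <= u -> 0 < fam_ratio u.
Proof.
move=> hu; rewrite divr_gt0 // ltr0z; first by lia.
by apply: mulr_gt0; [apply: exprn_gt0|]; lia.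
Qed.

Lemma fam_ratio_le u : 4 <= u -> fam_ratio u <= 1 / 2.
Proof.
move=> hu; rewrite ler_pdivrMr; last first.
  by rewrite ltr0z; apply: mulr_gt0; [apply: exprn_gt0|]; lia.
have : 2 * (2 * u + 1) <= (u + 1) ^+ 3 * (u - 1) by nia.
by rewrite -(ler_int rat); lra.
Qed.

Lemma fam_ratio_decr u v : 4 <= u -> u < v -> fam_ratio v < fam_ratio u.
Proof.
move=> hu uv; have pos t : 4 <= t -> 0 < ((t + 1) ^+ 3 * (t - 1))%:~R :> rat.
  by move=> ht; rewrite ltr0z; apply: mulr_gt0; [apply: exprn_gt0|]; lia.
have pv := pos v (le_trans hu (ltW uv)); have pu := pos u hu.
rewrite /fam_ratio ltr_pdivrMr // mulrAC ltr_pdivlMr // -!rmorphM ltr_int.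
have -> : (2 * v + 1) * ((u + 1) ^+ 3 * (u - 1)) = (u + 1) ^+ 3 * ((2 * v + 1) * (u - 1)) by ring.
have -> : (2 * u + 1) * ((v + 1) ^+ 3 * (v - 1)) = (v + 1) ^+ 3 * ((2 * u + 1) * (v - 1)) by ring.
apply: ltr_pM.
- by apply: exprn_ge0; lia.
- by apply: mulr_ge0; lia.
- by rewrite ltrXn2r //; lia.
by nia.
Qed.

(** The j-invariant in terms of [R = r (1 + r)], where [r] is the ratio of the consecutive
    differences of the roots. Its derivative has the sign of [R - 2] for positive [R]. *)
Definition j_ratio (F : realFieldType) (R : F) : F := 256 * (1 + R) ^+ 3 / R ^+ 2.

Lemma j_ratio_decr (F : realFieldType) (R S : F) : 0 < R -> R < S -> S <= 1 -> j_ratio S < j_ratio R.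
Proof.
move=> R0 RS S1; have S0 := lt_trans R0 RS.
rewrite /j_ratio ltr_pdivrMr ?exprn_gt0 // mulrAC ltr_pdivlMr ?exprn_gt0 // -subr_gt0.
have -> : 256 * (1 + R) ^+ 3 * S ^+ 2 - 256 * (1 + S) ^+ 3 * R ^+ 2 =
   256 * ((S - R) * (S + R + 2 * (R * S) + R * S * (1 - R * S))) by ring.
have RS1 : R * S <= 1 by exact: (mulr_ile1 (ltW R0) (ltW S0) (ltW (lt_le_trans RS S1)) S1).
have RSp : 0 < R * S by rewrite mulr_gt0.
have h : 0 <= R * S * (1 - R * S) by rewrite mulr_ge0 ?subr_ge0 // ltW.
by rewrite mulr_gt0 // mulr_gt0 ?subr_gt0 //; lra.
Qed.

Lemma j_ratio_quad_decr (F : realFieldType) (r s : F) : 0 < s -> s < r -> r <= 1 / 2 ->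
  j_ratio (r * (1 + r)) < j_ratio (s * (1 + s)).
Proof.
move=> s0 sr r2; apply: j_ratio_decr; last by nra.
  by apply: mulr_gt0; lra.
by apply: ltr_pM; lra.
Qed.

(* With x, y the two consecutive differences of the 2-torsion abscissas,
   j = 256 (x^2 + x y + y^2)^3 / (x y (x + y))^2. *)
Lemma fam_j u c : 4 <= u -> 3 * c = (u ^+ 2 + u + 1) ^+ 2 ->
  j_invariant (fam_a u c) (fam_b u c) = j_ratio (fam_ratio u * (1 + fam_ratio u)).
Proof.
move=> hu hc; pose x := (u + 1) ^+ 3 * (u - 1); pose y := 2 * u + 1.
have sum0 := family_sum0 hc.
have xE : fam_e2 u c - fam_e1 u c = x by rewrite /fam_e1 /fam_e2 /x; ring.
have yE : fam_e3 u c - fam_e2 u c = y by rewrite /fam_e3 /fam_e2 /y; ring.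
have A3 : 3 * root_coefA (fam_e1 u c) (fam_e2 u c) (fam_e3 u c) = - (x ^+ 2 + x * y + y ^+ 2).
  rewrite -xE -yE /root_coefA.
  have -> : fam_e3 u c = - fam_e1 u c - fam_e2 u c by rewrite -[LHS]addr0 -oppr0 -sum0; ring.
  by ring.
have dE : ec_disc (fam_a u c) (fam_b u c) = - (x%:~R * y%:~R * (x%:~R + y%:~R)) ^+ 2.
  transitivity ((4 * root_coefA (fam_e1 u c) (fam_e2 u c) (fam_e3 u c) ^+ 3
     + 27 * root_coefB (fam_e1 u c) (fam_e2 u c) (fam_e3 u c) ^+ 2)%:~R : rat).
    by rewrite /ec_disc /fam_a /fam_b; ring.
  by rewrite (full_disc sum0) -xE -yE; ring.
have x0 : x%:~R != 0 :> rat.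
  by rewrite intr_eq0 lt0r_neq0 //; apply: mulr_gt0; [apply: exprn_gt0|]; lia.
have y0 : y%:~R != 0 :> rat by rewrite intr_eq0 lt0r_neq0 // /y; lia.
have xy0 : x%:~R + y%:~R != 0 :> rat.
  rewrite -rmorphD intr_eq0 lt0r_neq0 //; apply: addr_gt0; last by rewrite /y; lia.
  by apply: mulr_gt0; [apply: exprn_gt0|]; lia.
have aE : fam_a u c = - (x%:~R ^+ 2 + x%:~R * y%:~R + y%:~R ^+ 2) / 3.
  have := congr1 (intr : int -> rat) A3; rewrite rmorphM /= -/(fam_a u c) => h.
  by apply: (canRL (mulfK _)) => //; rewrite mulrC h; ring.
rewrite /j_invariant dE aE /j_ratio /fam_ratio -/x -/y.
by field; rewrite x0 y0 xy0.
Qed.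

Theorem theorem1p3 :
  exists a b : nat -> rat,
    [/\ (forall n, nonsingular (a n) (b n)),
        injective (fun n => j_invariant (a n) (b n)) &
        forall n, exists K : nat -> algC -> Prop,
          [/\ (forall m, cyclic_cubic (K m)),
              linearly_disjoint K &
              forall m, gains_rank (a n) (b n) (K m)]].
Proof.
(* [u] is 1 modulo 3, so 3 divides [N] and [c = N^2 / 3] is an integer; 4 is the first such value
   above 1. *)
pose u (n : nat) : int := 3 * n%:Z + 4.
pose c (n : nat) : int := 3 * (3 * n%:Z ^+ 2 + 9 * n%:Z + 7) ^+ 2.
have u4 n : 4 <= u n by rewrite /u; lia.
have hc n : 3 * c n = (u n ^+ 2 + u n + 1) ^+ 2 by rewrite /c /u; ring.
exists (fun n => fam_a (u n) (c n)), (fun n => fam_b (u n) (c n)); split.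
- move=> n; apply: full_nonsingular (family_sum0 (hc n)).
  + exact: family_neq12.
  + exact: family_neq13.
  + exact: family_neq23.
- have decr m n : (m < n)%N -> j_invariant (fam_a (u m) (c m)) (fam_b (u m) (c m)) <
      j_invariant (fam_a (u n) (c n)) (fam_b (u n) (c n)).
    move=> mn; have uv : u m < u n by rewrite /u; lia.
    rewrite (fam_j (u4 m) (hc m)) (fam_j (u4 n) (hc n)).
    exact: j_ratio_quad_decr (fam_ratio_gt0 (u4 n)) (fam_ratio_decr (u4 m) uv) (fam_ratio_le (u4 m)).
  move=> m n; cbv beta => e; have [mn|mn|//] := ltngtP m n; exfalso.
    exact: (elimF eqP (lt_eqF (decr m n mn)) e).
  exact: (elimF eqP (lt_eqF (decr n m mn)) (esym e)).
by move=> n; apply: fam_cubic_fields.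
Qed.
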